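(* Let $\Sigma$ be a compact Riemann surface of genus $h$ with Riemann period matrix $\Omega$, and suppose that there are integer vectors $\mathbf{n},\mathbf{m},\mathbf{n}',\mathbf{m}'\in\mathbb{Z}^h$ and a non-rational $c\in\mathbb{C}$, with $\operatorname{Im}\overline{c}>0$, such that $$\mathbf{m}_j'-\sum_{k=1}^h\Omega_{jk}\mathbf{n}_k'=\overline{c}\Big(\mathbf{m}_j-\sum_{k=1}^h\Omega_{jk}\mathbf{n}_k\Big),\qquad j=1,\dots,h.$$ Put $\hat\omega=\sum_{k=1}^h(\overline{c}\,\mathbf{n}_k-\mathbf{n}_k')\,\omega_k$. By means of the holomorphic map $w(z)=\int^z\hat\omega$ from $\Sigma$ to the torus with period matrix $\operatorname{sign}(\operatorname{Im}\overline{c})\,\overline{c}$, one can construct an infinite set of eigenfunctions for the Laplacian $$\Delta=-2|\hat\omega|^{-2}\partial_z\partial_{\bar z}$$ on $\Sigma$ defined with respect to the metric $|\hat\omega|^2$. These eigenfunctions are $$h_{n,m}=e^{c_{n,m}\int^z\hat\omega-\overline{c}_{n,m}\overline{\int^z\hat\omega}},\qquad (n,m)\in\mathbb{Z}^2,$$ corresponding to the eigenvalues $$\lambda_{n,m}=2|c_{n,m}|^2=2\pi^2\,\frac{(m-c\,n)(m-\overline{c}\,n)}{(c^{(2)})^2},$$ where $$c_{n,m}=\pi\,\frac{m-n\,\overline{c}}{c^{(2)}},\qquad (n,m)\in\mathbb{Z}^2.$$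
   Context: Let $\alpha_1,\dots,\alpha_h,\beta_1,\dots,\beta_h$ be a symplectic basis of $H_1(\Sigma,\mathbb{Z})$, and let $\omega_1,\dots,\omega_h$ be the basis of holomorphic one-differentials on $\Sigma$ with $\oint_{\alpha_j}\omega_k=\delta_{jk}$. The Riemann period matrix is $\Omega_{jk}=\oint_{\beta_j}\omega_k$. Boldface letters denote vectors in $\mathbb{Z}^h$, while $n,m$ in $h_{n,m}$, $\lambda_{n,m}$ and $c_{n,m}$ are single integers. The superscript $(2)$ denotes the imaginary part, so $c^{(2)}=\operatorname{Im}c$. Integrals $\int^z$ start at a fixed point of $\Sigma$. If $\hat\omega=u(z)\,dz$ in a local coordinate, then $|\hat\omega|^{-2}$ in the formula for $\Delta$ stands for $|u(z)|^{-2}$; equivalently, $\Delta=-2\partial_w\partial_{\bar w}$.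
   Formalization: The constants are taken as c_{n,m} = π(m − n c)/Im c instead of the printed π(m − n c̄)/Im c, for which h_{n,m} is in general not single-valued on Σ; infinitude of the set of eigenfunctions is claimed when ω̂ is not identically zero (it vanishes only if all integer vectors are zero). *)

(* Defs.v *)
From HB Require Import structures.
From mathcomp Require Import all_boot all_order all_algebra.
From mathcomp Require Import complex.
From mathcomp Require Import all_classical all_reals all_analysis.
From mathcomp Require Export freeg.

Set Implicit Arguments.
Unset Strict Implicit.
Unset Printing Implicit Defensive.

Import Order.TTheory GRing.Theory Num.Theory.
Import numFieldNormedType.Exports.

Local Open Scope classical_set_scope.
Local Open Scope ring_scope.
Local Open Scope complex_scope.

(* The complex plane is the regular module [R[i]^o]: this alias carries the
   topology and the normed structure over the field [R[i]], so that [derivable]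
   and [derive1] at this type are complex differentiability and the complex
   derivative. *)
Notation Cplx R := (R[i]^o) (only parsing).

Section ComplexFunctions.
Variable R : realType.
Implicit Types (f : Cplx R -> Cplx R) (z : Cplx R).

Definition Cexp z : Cplx R :=
  (expR (complex.Re z) * cos (complex.Im z)) +i*
  (expR (complex.Re z) * sin (complex.Im z)).

Definition slice f z (v : Cplx R) (t : R) : Cplx R := f (z + t%:C * v).

Definition pderivable f z (v : Cplx R) : Prop :=
  derivable (fun t : R => complex.Re (slice f z v t)) 0 1 /\
  derivable (fun t : R => complex.Im (slice f z v t)) 0 1.

Definition pderiv (v : Cplx R) f z : Cplx R :=
  derive1 (fun t : R => complex.Re (slice f z v t)) 0 +i*
  derive1 (fun t : R => complex.Im (slice f z v t)) 0.

(* Class C^n, in the real sense, on an open set [U] of the plane. *)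
Fixpoint Cn (n : nat) (U : set (Cplx R)) f : Prop :=
  (forall z, U z -> {for z, continuous f}) /\
  (if n is p.+1 then
     (forall z, U z -> pderivable f z 1 /\ pderivable f z 'i) /\
     Cn p U (pderiv 1 f) /\ Cn p U (pderiv 'i f)
   else True).

(* Wirtinger operators d/dz and d/d(bar z). *)
Definition dz f z : Cplx R := (pderiv 1 f z - 'i * pderiv 'i f z) / 2%:R.
Definition dzbar f z : Cplx R := (pderiv 1 f z + 'i * pderiv 'i f z) / 2%:R.

End ComplexFunctions.

(* The values of [cinv] outside [cmap @` cdom], and of [cmap] outside [cdom],
   are irrelevant. *)
Record chart (R : realType) (X : topologicalType) := Chart {
  cdom : set X;
  cmap : X -> Cplx R;
  cinv : Cplx R -> X;
  cdom_open : open cdom;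
  cimg_open : open (cmap @` cdom);
  cmapK : forall x, cdom x -> cinv (cmap x) = x;
  cmap_continuous : forall x, cdom x -> {for x, continuous cmap};
  cinv_continuous : forall z, (cmap @` cdom) z -> {for z, continuous cinv}
}.

Definition transition (R : realType) (X : topologicalType)
  (phi psi : chart R X) : Cplx R -> Cplx R := cmap psi \o cinv phi.

(* Second countability is not required: it is a consequence of the other
   axioms, and obvious in the compact case. *)
Record riemann_surface (R : realType) := RiemannSurface {
  points :> topologicalType;
  atlas : set (chart R points);
  surface_hausdorff : hausdorff_space points;
  surface_connected : connected [set: points];
  atlas_cover : forall x, exists2 phi, atlas phi & cdom phi x;
  atlas_compatible : forall phi psi x, atlas phi -> atlas psi ->
    cdom phi x -> cdom psi x -> derivable (transition phi psi) (cmap phi x) 1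
}.

Section Homology.
Variables (R : realType) (X : topologicalType).

Definition clamp (t : R) : R := Num.max 0 (Num.min 1 t).

(* Singular 1-simplices [0,1] -> X, extended to the whole line by constants so
   that equality of simplices is equality of functions. *)
Definition path1 := {g : R -> X |
  `[< continuous g /\ forall t, g t = g (clamp t) >]}.
HB.instance Definition _ := Choice.on path1.

Definition triangle : set (R * R) :=
  [set p | [/\ 0 <= p.1, 0 <= p.2 & p.1 + p.2 <= 1]].

(* Singular 2-simplices; the values outside the triangle are irrelevant, as they
   do not affect the faces. *)
Definition simplex2 := {s : R * R -> X | `[< {within triangle, continuous s} >]}.
HB.instance Definition _ := Choice.on simplex2.

(* The faces of the triangle with vertices (0,0), (1,0), (0,1); the i-th one is
   opposite to the i-th vertex. *)
Definition edge (i : nat) (t : R) : R * R :=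
  match i with
  | 0%N => (1 - t, t)
  | 1%N => (0, t)
  | _ => (t, 0)
  end.

Lemma clampP (t : R) : 0 <= clamp t <= 1.
Proof.
rewrite /clamp le_max lexx /= ge_max ler01 /=.
by rewrite ge_min lexx.
Qed.

Lemma clamp_id (t : R) : 0 <= t <= 1 -> clamp t = t.
Proof. by case/andP => t0 t1; rewrite /clamp min_r // max_r. Qed.

Lemma continuous_clamp : continuous clamp.
Proof.
move=> t.
have c1 : {for t, continuous ((fun=> 1 : R^o) \min (id : R -> R^o))}.
  by apply: continuous_min; [exact: cst_continuous | exact: cvg_id].
have c0 : {for t, continuous (fun=> 0 : R^o)} by exact: cst_continuous.
by rewrite /clamp; exact: (continuous_max c0 c1).
Qed.

Lemma edge_in_triangle i t : 0 <= t <= 1 -> triangle (edge i t).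
Proof.
case/andP => t0 t1; case: i => [|[|i]]; split => //=.
- by rewrite subr_ge0.
- by rewrite subrK.
- by rewrite add0r.
- by rewrite addr0.
Qed.

Lemma continuous_edge i : continuous (edge i).
Proof.
move=> t.
have pairC (f g : R -> R) : {for t, continuous f} -> {for t, continuous g} ->
    {for t, continuous (fun u => (f u, g u))}.
  by move=> cf cg; exact: (cvg_pair cf cg).
have idC : {for t, continuous (id : R -> R)} by exact: cvg_id.
have cstC (a : R) : {for t, continuous (fun=> a : R)} by exact: cvg_cst.
case: i => [|[|i]].
- apply: (pairC (fun u => 1 - u) id) => //.
  by apply: (@cvgB R R^o R (nbhs t)); [exact: (cstC 1) | exact: idC].
- exact: (pairC (fun=> 0) id).
- exact: (pairC id (fun=> 0)).
Qed.

Definition face_fun (i : nat) (s : simplex2) : R -> X :=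
  fun t => val s (edge i (clamp t)).

Lemma face_proof i s :
  `[< continuous (face_fun i s) /\
      forall t, face_fun i s t = face_fun i s (clamp t) >].
Proof.
apply/asboolP; split; last first.
  by move=> t; rewrite /face_fun (clamp_id (clampP t)).
have /asboolP /subspace_continuousP cs := valP s.
move=> t; rewrite /face_fun.
have tri u : triangle (edge i (clamp u)).
  exact/edge_in_triangle/clampP.
have ce : {for t, continuous (edge i \o clamp)}.
  by apply: continuous_comp; [exact: continuous_clamp | exact: continuous_edge].
move=> A /(cs _ (tri t)) /ce; rewrite /= !nbhs_simpl /=.
by apply: (@filterS _ (nbhs t)) => u; apply; exact: tri.
Qed.

Definition face (i : nat) (s : simplex2) : path1 :=
  exist _ (face_fun i s) (face_proof i s).

Definition chain0 := {freeg X / int}.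
Definition chain1 := {freeg path1 / int}.
Definition chain2 := {freeg simplex2 / int}.

Definition boundary1 (c : chain1) : chain0 :=
  \sum_(g <- dom c) (<< val g 1 >> - << val g 0 >>) *~ coeff g c.

Definition boundary2 (e : chain2) : chain1 :=
  \sum_(s <- dom e)
    (<< face 0 s >> - << face 1 s >> + << face 2 s >>) *~ coeff s e.

Definition cycle1 (c : chain1) : Prop := boundary1 c = 0.

(* Elements of H_1(X, Z) are represented by 1-cycles; equality in H_1 is
   [homologous]. *)
Definition homologous (c d : chain1) : Prop := exists e, c - d = boundary2 e.

Definition homology_basis (n : nat) (e : 'I_n -> chain1) : Prop :=
  (forall i, cycle1 (e i)) /\
  (forall c, cycle1 c ->
     exists! k : {ffun 'I_n -> int}, homologous c (\sum_i e i *~ k i)).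

End Homology.

Arguments simplex2 : clear implicits.
Arguments path1 : clear implicits.
Arguments chain1 : clear implicits.

(* For a compact connected orientable surface H_1 is free of rank 2h, where h is
   the genus. *)
Definition has_genus (R : realType) (S : riemann_surface R) (h : nat) : Prop :=
  exists e : 'I_(h + h) -> chain1 R S, homology_basis e.

Section Intersection.
Variables (R : realType) (S : riemann_surface R).
Implicit Types (g d : R -> S) (phi : chart R S).

Definition velocity phi g (t : R) : Cplx R :=
  derive1 (fun s => complex.Re (cmap phi (g s))) t +i*
  derive1 (fun s => complex.Im (cmap phi (g s))) t.

Definition C1_loop g : Prop :=
  [/\ continuous g,
      forall t, g (t + 1) = g t &
      forall phi t, atlas phi -> cdom phi (g t) ->
        (\forall s \near t, derivable (fun s => complex.Re (cmap phi (g s))) s 1 /\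
                            derivable (fun s => complex.Im (cmap phi (g s))) s 1) /\
        {for t, continuous (velocity phi g)}].

Definition loop_represents g (c : chain1 R S) : Prop :=
  exists2 p : path1 R S,
    (forall t, 0 <= t <= 1 -> val p t = g t) & homologous << p >> c.

Definition crossing g d (p : R * R) : Prop :=
  [/\ 0 <= p.1 < 1, 0 <= p.2 < 1 & g p.1 = d p.2].

(* [Im (conj u * v)] is the determinant of the pair of plane vectors (u, v): it
   is positive when (u, v) is a direct basis. *)
Definition positive_crossing g d (p : R * R) : Prop :=
  crossing g d p /\ exists phi, [/\ atlas phi, cdom phi (g p.1) &
    0 < complex.Im ((velocity phi g p.1)^* * velocity phi d p.2)].

Definition negative_crossing g d (p : R * R) : Prop :=
  crossing g d p /\ exists phi, [/\ atlas phi, cdom phi (g p.1) &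
    complex.Im ((velocity phi g p.1)^* * velocity phi d p.2) < 0].

(* The intersection pairing on H_1: the signed number of crossings of loops
   representing the two classes and meeting transversally in finitely many
   points. *)
Definition intersection_number (a b : chain1 R S) (k : int) : Prop :=
  exists (g d : R -> S) (P N : seq (R * R)),
    [/\ C1_loop g /\ loop_represents g a,
        C1_loop d /\ loop_represents d b,
        (forall p, crossing g d p <-> (p \in P) || (p \in N)),
        uniq P /\ (forall p, p \in P -> positive_crossing g d p) &
        uniq N /\ (forall p, p \in N -> negative_crossing g d p)] /\
    k = (size P)%:Z - (size N)%:Z.

Definition symplectic_basis (h : nat) (alpha beta : 'I_h -> chain1 R S) : Prop :=
  homology_basis (fun i : 'I_(h + h) =>
    match fintype.split i with inl j => alpha j | inr j => beta j end) /\
  (forall j k : 'I_h,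
    [/\ intersection_number (alpha j) (beta k) (j == k)%:Z,
        intersection_number (alpha j) (alpha k) 0 &
        intersection_number (beta j) (beta k) 0]).

End Intersection.

Section Forms.
Variables (R : realType) (S : riemann_surface R).

(* A one-form of type (1,0) is given by its coefficient u in each chart, the form
   being u(z) dz there; only the values on the images of the charts of the atlas
   matter, whence [eq_form]. *)
Definition one_form := chart R S -> Cplx R -> Cplx R.

Implicit Types eta : one_form.

Definition holomorphic_form eta : Prop :=
  (forall phi x, atlas phi -> cdom phi x ->
     derivable (eta phi) (cmap phi x) 1) /\
  (forall phi psi x, atlas phi -> atlas psi -> cdom phi x -> cdom psi x ->
     eta phi (cmap phi x) =
     eta psi (cmap psi x) * derive1 (transition phi psi) (cmap phi x)).

Definition eq_form eta eta' : Prop :=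
  forall phi x, atlas phi -> cdom phi x ->
    eta phi (cmap phi x) = eta' phi (cmap phi x).

Definition lincomb_form (h : nat) (a : 'I_h -> R[i]) (om : 'I_h -> one_form)
  : one_form := fun phi z => \sum_k a k * om k phi z.

Definition holomorphic_basis (h : nat) (om : 'I_h -> one_form) : Prop :=
  (forall k, holomorphic_form (om k)) /\
  (forall eta, holomorphic_form eta ->
     exists! a : {ffun 'I_h -> R[i]}, eq_form eta (lincomb_form a om)).

(* The integral of a holomorphic form along a continuous path: the variation of a
   primitive [F] of the form along the path, i.e. a function of the parameter
   which locally is a local primitive of the form composed with the path. Such
   an [F] exists and is unique up to a constant, so that the default value in
   [path_integral] is never used. *)
Definition is_path_integral eta (g : path1 R S) (I : R[i]) : Prop :=
  exists F : R -> R[i],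
    (forall t, 0 <= t <= 1 ->
       exists (phi : chart R S) (G : Cplx R -> Cplx R),
         [/\ atlas phi, cdom phi (val g t),
             (\forall z \near cmap phi (val g t), is_derive (z : Cplx R) 1 G (eta phi z)) &
             (\forall s \near t, 0 <= s <= 1 -> F s = G (cmap phi (val g s)))]) /\
    I = F 1 - F 0.

Definition path_integral eta (g : path1 R S) : R[i] :=
  xget 0 [set I | is_path_integral eta g I].

Definition chain_integral eta (c : chain1 R S) : R[i] :=
  \sum_(g <- dom c) path_integral eta g *~ coeff g c.

Definition joins (x y : S) (g : path1 R S) : Prop :=
  val g 0 = x /\ val g 1 = y.

End Forms.

Section Laplacian.
Variables (R : realType) (S : riemann_surface R).

Definition in_chart (phi : chart R S) (f : S -> R[i]) : Cplx R -> Cplx R :=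
  f \o cinv phi.

Definition smooth (f : S -> R[i]) : Prop :=
  forall phi n, atlas phi -> Cn n (cmap phi @` cdom phi) (in_chart phi f).

(* The Laplacian of the metric |eta|^2, in the chart [phi]. *)
Definition laplacian (eta : one_form S) (phi : chart R S) (f : S -> R[i])
    (z : Cplx R) : R[i] :=
  - 2%:R * (`|eta phi z| ^+ 2)^-1 * dz (dzbar (in_chart phi f)) z.

(* The metric |eta|^2 degenerates at the zeros of eta, where the Laplacian is not
   defined. *)
Definition eigenfunction (eta : one_form S) (f : S -> R[i]) (lambda : R[i]) :
    Prop :=
  [/\ smooth f,
      exists x, f x != 0 &
      forall phi x, atlas phi -> cdom phi x -> eta phi (cmap phi x) != 0 ->
        laplacian eta phi f (cmap phi x) = lambda * f x].

End Laplacian.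

Section Torus.
Variable R : realType.

(* The point of the torus C / (Z + tau Z) below [v], as a coset. *)
Definition torus_point (tau v : R[i]) : set R[i] :=
  [set u | exists a b : int, u = v + a%:~R + b%:~R * tau].

(* The complex structure of the torus is the quotient one: a map to it is
   holomorphic when it lifts locally to holomorphic functions. *)
Definition holomorphic_to_torus (S : riemann_surface R) (tau : R[i])
    (w : S -> set R[i]) : Prop :=
  forall phi x, atlas phi -> cdom phi x ->
    exists F : Cplx R -> Cplx R, \forall z \near cmap phi x,
      derivable F z 1 /\ w (cinv phi z) = torus_point tau (F z).

(* The function exp (C w - conj(C w)) is invariant under the period lattice
   Z + conj(c) Z of w iff Im C and Im (conj(c) C) lie in pi Z, which is solved by C = pi (m - n c) / Im c; with conj(c) in place of c
   the second condition would fail unless 2 n Re c is an integer. *)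
Definition cnm (c : R[i]) (n m : int) : R[i] :=
  (pi : R)%:C * (m%:~R - n%:~R * c) / (complex.Im c)%:C.

Definition lambda_nm (c : R[i]) (n m : int) : R[i] := 2%:R * `|cnm c n m| ^+ 2.

End Torus.

(* Main.v *)
From HB Require Import structures.
Require Import Defs.
From mathcomp Require Import all_boot all_order all_algebra.
From mathcomp Require Import complex.
From mathcomp Require Import all_classical all_reals all_analysis.
From mathcomp Require Import ring lra.
Import Order.TTheory GRing.Theory Num.Theory.
Import numFieldNormedType.Exports.
Local Open Scope classical_set_scope.
Local Open Scope ring_scope.
Local Open Scope complex_scope.

Set Implicit Arguments.
Unset Strict Implicit.
Unset Printing Implicit Defensive.

(* The form omhat is holomorphic, hence closed: it has local primitives, so its
   integral along a path depends only on the ends of the path modulo the periods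
   of omhat. The hypothesis on Omega says that its periods along alpha_j and
   beta_j are conj(c) n_j - n'_j and conj(c) m_j - m'_j, so that w is defined
   modulo Z + conj(c) Z; the constants c_{n,m} are those for which
   exp(C w - conj(C w)) is invariant under this lattice. In a chart, with
   omhat = u dz, this function f has d/dz f = C u f and
   d/d(bar z) f = - conj(C u) f, whence the eigenvalue 2 |C|^2, and its
   smoothness is that of the holomorphic function u. Infinitely many of the
   eigenvalues are distinct, hence infinitely many of the eigenfunctions.
   The forms are only assumed to be complex differentiable: Goursat's lemma gives
   the local primitives, and Cauchy's formula the smoothness of u. The homology
   invariance follows from the existence of a primitive along a continuous map
   from a square to the surface, obtained by subdivision. *)

(** * Complex numbers and complex derivatives *)

(** Two kinds of derivatives meet: complex ones for holomorphic functions, componentwise real ones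
    for curves and for [pderiv]. Both are brought to Caratheodory's form, a continuous slope q with
    f w - f x = q w (w - x), so that the mixed chain rule is a product of slopes. Integrals of
    curves are variations of a primitive, and all estimates on them come from the mean value
    inequality; it is applied to real and imaginary parts, which costs a factor 2 each time and
    explains the constants e / 4 below. Cauchy's formula is proved by differentiation under the
    integral sign, which asks for a continuous derivative. A holomorphic f is not yet known to have
    one, but its primitive F does; so the formula is applied to F, and f and its derivative are the
    next two terms. No universal cover is built. The map w is integrated along a path chosen
    arbitrarily for each point, with no continuity in the point; a change of path adds the integral
    of a cycle, which lies in the period lattice and is erased by the passage to the torus or by
    [unit_exp]. *)

Lemma is_derive_caratheodory (K : numFieldType) (f : K -> K) (x a : K) :
  is_derive x (1 : K) f a <->
  exists q : K -> K, [/\ forall w, f w - f x = q w * (w - x),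
        {for x, continuous q} & q x = a].
Proof.
pose quot h := h^-1 *: (f (h *: (1 : K) + x) - f x).
split=> [[df <-]|[q [qE cq <-]]].
  pose q w := if w == x then 'D_(1 : K) f x else (f w - f x) / (w - x).
  have qx : q x = 'D_(1 : K) f x by rewrite /q eqxx.
  have qn w : w != x -> q w = (f w - f x) / (w - x) by rewrite /q => /negPf ->.
  exists q; split; last by [].
    by move=> w; have [->|wx] := eqVneq w x; rewrite ?subrr ?mulr0// qn// divfK// subr_eq0.
  apply/(@cvgrPdist_le _ _ _ (nbhs x)) => e e0.
  have dq : quot @ 0^' --> 'D_(1 : K) f x by exact: df.
  have : \forall h \near 0^', `|'D_(1 : K) f x - quot h| <= e.
    by move/cvgrPdist_le: dq; apply.
  rewrite near_withinE => /nbhs_ballP[d /= d0 H].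
  apply/nbhs_ballP; exists d => // w; rewrite /ball /= distrC => wd.
  have [->|wx] := eqVneq w x; first by rewrite subrr normr0 ltW.
  have wx0 : w - x != 0 by rewrite subr_eq0.
  have := H (w - x); rewrite /ball /= sub0r normrN => /(_ wd wx0).
  by rewrite qx qn// /quot [_ *: 1]mulr1 subrK /GRing.scale /= mulrC.
have lim : quot @ 0^' --> q x.
  have sx : (fun h : K => h + x) @ 0^' --> x.
    have h0 : (fun h : K => h + x) @ (0 : K) --> 0 + x.
      exact: (cvgD cvg_id (cvg_cst x)).
    by rewrite add0r in h0; exact: cvg_within_filter.
  apply: cvg_trans (cvg_comp _ _ sx cq); apply: near_eq_cvg.
  rewrite near_withinE; apply: filterE => h h0.
  by rewrite /quot [_ *: 1]mulr1 /= qE addrK /GRing.scale /= mulrC mulfK.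
by apply: DeriveDef; [apply/cvg_ex; exists (q x)|exact: cvg_lim].
Qed.

Section ComplexBasics.
Variable R : realType.
Implicit Types (z w : Cplx R).
Local Notation C := (Cplx R).
Local Notation Re := complex.Re.
Local Notation Im := complex.Im.

Lemma creD (x y : R[i]) : Re (x + y) = Re x + Re y. Proof. by case: x y => ? ? []. Qed.
Lemma cimD (x y : R[i]) : Im (x + y) = Im x + Im y. Proof. by case: x y => ? ? []. Qed.
Lemma creN (x : R[i]) : Re (- x) = - Re x. Proof. by case: x. Qed.
Lemma cimN (x : R[i]) : Im (- x) = - Im x. Proof. by case: x. Qed.
Lemma creM (x y : R[i]) : Re (x * y) = Re x * Re y - Im x * Im y.
Proof. by case: x y => ? ? []. Qed.
Lemma cimM (x y : R[i]) : Im (x * y) = Re x * Im y + Im x * Re y.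
Proof. by case: x y => ? ? []. Qed.
Lemma creJ (x : R[i]) : Re x^* = Re x. Proof. by case: x. Qed.
Lemma cimJ (x : R[i]) : Im x^* = - Im x. Proof. by case: x. Qed.

Lemma complex_ext (x y : R[i]) : Re x = Re y -> Im x = Im y -> x = y.
Proof. by case: x y => ? ? [? ?] /= -> ->. Qed.

Lemma norm_realc (x : R) : `|x%:C| = `|x|%:C.
Proof. by rewrite normc_def /= expr0n addr0 sqrtr_sqr. Qed.

Lemma norm_i : `|'i : R[i]| = 1.
Proof. by rewrite normc_def /= expr0n add0r expr1n sqrtr1. Qed.

Lemma norm_Re_Im (x : R[i]) : `|x| <= (`|Re x| + `|Im x|)%:C.
Proof.
rewrite [X in `|X|](complexE x) (le_trans (ler_normD _ _))//.
by rewrite normrM norm_i mul1r !norm_realc rmorphD.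
Qed.

Lemma normc_ge_Im (x : R[i]) : `|Im x|%:C <= `|x|.
Proof.
have -> : Im x = - Re ('i * x) by rewrite creM /= mul0r mul1r sub0r opprK.
by rewrite normrN (le_trans (normc_ge_Re _))// normrM norm_i mul1r.
Qed.

(** The order of [R[i]] compares only numbers with equal imaginary parts, so a positive radius is
    real. This is how every complex epsilon is traded for a real one. *)
Lemma gt0_complexE (e : R[i]) : 0 < e -> e = (Re e)%:C /\ 0 < Re e.
Proof. by case: e => a b; rewrite ltcE /= => /andP[/eqP -> ->]. Qed.

Section Cvg.
Context {T : Type} (F : set_system T) {FF : Filter F}.

Lemma cvgcP (f : T -> C) (l : C) :
  (forall e : R, 0 < e -> \forall t \near F, `|l - f t| < e%:C) <-> f @ F --> l.
Proof.
split.
  move=> H; apply/cvgrPdist_lt => e /gt0_complexE[-> e0]; exact: H.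
by move=> /cvgrPdist_lt H e e0; apply: H; rewrite ltcR.
Qed.

Lemma cvg_Re (f : T -> C) (l : C) : f @ F --> l -> (fun t => Re (f t)) @ F --> (Re l : R).
Proof.
move/cvgcP => H; apply/cvgrPdist_lt => e /H; apply: filterS => t.
rewrite -creN -creD -ltcR; exact/le_lt_trans/normc_ge_Re.
Qed.

Lemma cvg_Im (f : T -> C) (l : C) : f @ F --> l -> (fun t => Im (f t)) @ F --> (Im l : R).
Proof.
move/cvgcP => H; apply/cvgrPdist_lt => e /H; apply: filterS => t.
rewrite -cimN -cimD -ltcR; exact/le_lt_trans/normc_ge_Im.
Qed.

Lemma cvg_RI (f : T -> C) (l : C) : (fun t => Re (f t)) @ F --> (Re l : R) ->
  (fun t => Im (f t)) @ F --> (Im l : R) -> f @ F --> l.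
Proof.
move=> /cvgrPdist_lt H1 /cvgrPdist_lt H2; apply/cvgcP => e e0.
have e2 : 0 < e / 2 by rewrite divr_gt0.
have h1 := H1 _ e2; have h2 := H2 _ e2.
near=> t.
rewrite (le_lt_trans (norm_Re_Im _))// ltcR [e](splitr e) creD cimD creN cimN.
by rewrite ltrD//; near: t.
Unshelve. all: by end_near. Qed.

End Cvg.

Lemma continuous_realc : continuous (fun t : R => t%:C : C).
Proof. by move=> t; apply: (@cvg_RI _ (nbhs t)) => /=;
  [exact: cvg_id | exact: cvg_cst]. Qed.

Lemma continuous_Re : continuous (fun z : C => Re z : R).
Proof. move=> z; apply: (@cvg_Re _ (nbhs z)); exact: cvg_id. Qed.

Lemma continuous_Im : continuous (fun z : C => Im z : R).
Proof. move=> z; apply: (@cvg_Im _ (nbhs z)); exact: cvg_id. Qed.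

Lemma continuous_conjc : continuous (fun z : C => z^* : C).
Proof.
move=> z; apply: (@cvg_RI _ (nbhs z)).
  under eq_fun do rewrite creJ; rewrite creJ; exact: continuous_Re.
under eq_fun do rewrite cimJ; rewrite cimJ; apply: cvgN; exact: continuous_Im.
Qed.

Lemma nbhsC_ballP (z : C) (P : set C) :
  nbhs z P <-> exists2 e : R, 0 < e & forall w, `|w - z| < e%:C -> P w.
Proof.
split.
  move=> /nbhs_ballP[e /gt0_complexE[-> e0] H]; exists (Re e) => // w we.
  by apply: H; rewrite /ball /= distrC.
move=> [e e0 H]; apply/nbhs_ballP; exists e%:C; first by rewrite /= ltcR.
by move=> w; rewrite /ball /= distrC; apply: H.
Qed.

Lemma is_derivec_caratheodory (f : C -> C) (z d : C) :
  is_derive z (1 : C) f d <->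
  exists q : C -> C, [/\ forall w, f w - f z = q w * (w - z),
        {for z, continuous q} & q z = d].
Proof.
exact: (@is_derive_caratheodory R[i]). Qed.

End ComplexBasics.

(** * Derivatives of plane curves *)

Section FieldDerivative.
Variable K : numFieldType.
Implicit Types (f g : K -> K) (x a b : K).

Lemma is_derive_continuous f x a : is_derive x (1 : K) f a -> {for x, continuous f}.
Proof.
case=> + _ => /derivable1_diffP; exact: differentiable_continuous.
Qed.

Lemma is_derive_chain f g x a b :
  is_derive (g x) (1 : K) f a -> is_derive x (1 : K) g b ->
  is_derive x (1 : K) (f \o g) (a * b).
Proof.
move=> /is_derive_caratheodory[p [fE pc <-]] dg.
have gc := is_derive_continuous dg.
move: dg => /is_derive_caratheodory[q [gE qc <-]].
apply/is_derive_caratheodory; exists (fun w => p (g w) * q w); split => //.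
  by move=> w /=; rewrite fE gE mulrA.
apply: (@continuousM _ _ (p \o g) q) => //.
exact: continuous_comp.
Qed.

Lemma is_derive_affine a b x : is_derive x (1 : K) (fun w : K => b + a * w) a.
Proof.
apply/is_derive_caratheodory; exists (fun=> a); split => //; last exact: cst_continuous.
by move=> w; ring.
Qed.

Lemma is_derive_prod f g x a b : is_derive x (1 : K) f a -> is_derive x (1 : K) g b ->
  is_derive x (1 : K) (fun w => f w * g w) (a * g x + f x * b).
Proof.
move=> df dg; have := is_deriveM df dg.
by rewrite /= /GRing.scale/= addrC [g x * a]mulrC.
Qed.

Lemma is_derive_add f g x a b : is_derive x (1 : K) f a -> is_derive x (1 : K) g b ->
  is_derive x (1 : K) (fun w => f w + g w) (a + b).
Proof. by move=> df dg; exact: (is_deriveD df dg). Qed.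

Lemma is_derive_sumr n (f df : 'I_n -> K -> K) x :
  (forall i, is_derive x (1 : K) (f i) (df i x)) ->
  is_derive x (1 : K) (fun w => \sum_i f i w) (\sum_i df i x).
Proof.
move=> H; have := is_derive_sum H.
by congr is_derive; apply/funext => w; rewrite fct_sumE.
Qed.

Lemma is_derive_scale f x a b : is_derive x (1 : K) f a ->
  is_derive x (1 : K) (fun w => b * f w) (b * a).
Proof. by move=> df; exact: (is_deriveZ b df). Qed.

Lemma is_derive_inv f x a : f x != 0 -> is_derive x (1 : K) f a ->
  is_derive x (1 : K) (fun w => (f w)^-1) (- a / f x ^+ 2).
Proof.
move=> fx0 [df <-]; apply: DeriveDef; first exact: derivableV.
by rewrite deriveV//; rewrite /GRing.scale /= mulrC mulrN mulNr.
Qed.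

Lemma is_derive_near f g x a : (\forall w \near x, f w = g w) ->
  is_derive x (1 : K) f a -> is_derive x (1 : K) g a.
Proof. exact: near_eq_is_derive. Qed.

End FieldDerivative.

Section Curves.
Variable R : realType.
Local Notation C := (Cplx R).
Local Notation Re := complex.Re.
Local Notation Im := complex.Im.
Implicit Types (g : R -> C) (t : R) (d : C).

(** Componentwise, like [pderivable] and [pderiv], so that [cderive (slice f z v) 0 d] gives both
    the existence and the value of the partial derivative along [v]. *)
Definition cderive g t d : Prop :=
  is_derive t (1 : R) (fun s => Re (g s)) (Re d) /\
  is_derive t (1 : R) (fun s => Im (g s)) (Im d).

Lemma cderive_caratheodory g t d : cderive g t d <->
  exists q : R -> C, [/\ forall s, g s - g t = q s * (s - t)%:C,
    {for t, continuous q} & q t = d].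
Proof.
split.
  case=> /is_derive1_caratheodory[p [pE pc pd]] /is_derive1_caratheodory[q [qE qc qd]].
  exists (fun s => p s +i* q s); split.
  - move=> s; apply: complex_ext.
      by rewrite creD creN pE creM /= mulr0 subr0.
    by rewrite cimD cimN qE cimM /= mulr0 add0r.
  - exact: (@cvg_RI _ _ (nbhs t)).
  - by apply: complex_ext.
move=> [q [qE qc <-]]; split; apply/is_derive1_caratheodory.
  exists (fun s => Re (q s)); split => //; last exact: (@cvg_Re _ _ (nbhs t)).
  by move=> s; rewrite -creN -creD qE creM /= mulr0 subr0.
exists (fun s => Im (q s)); split => //; last exact: (@cvg_Im _ _ (nbhs t)).
by move=> s; rewrite -cimN -cimD qE cimM /= mulr0 add0r.
Qed.

Lemma cderive_continuous g t d : cderive g t d -> {for t, continuous g}.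
Proof. by case=> /is_derive_continuous h1 /is_derive_continuous h2;
  exact: (@cvg_RI _ _ (nbhs t)). Qed.

Lemma continuous_mulc (T : topologicalType) (f g : T -> C) (t : T) :
  {for t, continuous f} -> {for t, continuous g} ->
  {for t, continuous (fun s => f s * g s)}.
Proof. exact: (@continuousM R[i]). Qed.

Lemma continuous_addc (T : topologicalType) (f g : T -> C) (t : T) :
  {for t, continuous f} -> {for t, continuous g} ->
  {for t, continuous (fun s => f s + g s)}.
Proof. exact: (@continuousD R[i] C). Qed.

(** The bridge between complex and real derivatives: the slope of the composite is the complex slope
    of [f] along [g] times the real slope of [g]. *)
Lemma cderive_comp (f : C -> C) g t d e : is_derive (g t) (1 : C) f e ->
  cderive g t d -> cderive (f \o g) t (e * d).
Proof.
move=> /is_derivec_caratheodory[p [fE pc <-]] dg.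
have gc := cderive_continuous dg.
move: dg => /cderive_caratheodory[q [gE qc <-]].
apply/cderive_caratheodory; exists (fun w => p (g w) * q w); split; last by [].
  by move=> w; rewrite -mulrA -gE -fE.
apply: continuous_mulc; last exact: qc.
exact: (continuous_comp gc pc).
Qed.

Lemma cderive_line (z v : C) t : cderive (fun s : R => z + s%:C * v) t v.
Proof.
apply/cderive_caratheodory; exists (fun=> v); split; [|exact: cst_continuous|by []].
by move=> s; rewrite opprD addrACA subrr add0r -mulrBl -rmorphB mulrC.
Qed.

Lemma cderiveD g h t d e : cderive g t d -> cderive h t e ->
  cderive (fun s => g s + h s) t (d + e).
Proof.
move=> [g1 g2] [h1 h2]; split.
  under eq_fun do rewrite creD; rewrite creD; exact: is_derive_add.
under eq_fun do rewrite cimD; rewrite cimD; exact: is_derive_add.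
Qed.

Lemma cderiveN g t d : cderive g t d -> cderive (fun s => - g s) t (- d).
Proof.
move=> [g1 g2]; split.
  under eq_fun do rewrite creN; rewrite creN; exact: is_deriveN.
under eq_fun do rewrite cimN; rewrite cimN; exact: is_deriveN.
Qed.

Lemma cderiveJ g t d : cderive g t d -> cderive (fun s => (g s)^*) t (d^*).
Proof.
move=> [g1 g2]; split.
  by under eq_fun do rewrite creJ; rewrite creJ.
under eq_fun do rewrite cimJ; rewrite cimJ; exact: is_deriveN.
Qed.

Lemma cderiveM g h t d e : cderive g t d -> cderive h t e ->
  cderive (fun s => g s * h s) t (d * h t + g t * e).
Proof.
move=> [g1 g2] [h1 h2]; split.
  under eq_fun do rewrite creM; rewrite creD !creM.
  have := is_deriveB (is_derive_prod g1 h1) (is_derive_prod g2 h2).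
  by congr is_derive => /=; ring.
under eq_fun do rewrite cimM; rewrite cimD !cimM.
have := is_deriveD (is_derive_prod g1 h2) (is_derive_prod g2 h1).
by congr is_derive => /=; ring.
Qed.

Lemma cderive_cst (a : C) t : cderive (fun=> a) t 0.
Proof. by split; exact: is_derive_cst. Qed.

Lemma cderiveZ (a : C) g t d : cderive g t d -> cderive (fun s => a * g s) t (a * d).
Proof. by move=> /(cderiveM (cderive_cst a t)); rewrite mul0r add0r. Qed.

Lemma cderive_near g h t d : (\forall s \near t, g s = h s) ->
  cderive g t d -> cderive h t d.
Proof.
move=> gh [h1 h2]; split; [move: h1|move: h2]; apply: is_derive_near;
  by apply: filterS gh => s ->.
Qed.

Lemma mean_value_bound (f df : R -> R) (a b M : R) : a <= b ->
  (forall s, a <= s <= b -> is_derive s (1 : R) f (df s) /\ `|df s| <= M) ->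
  `|f b - f a| <= M * (b - a).
Proof.
move=> ab H.
have [||c cab ->] := @MVT_segment R f df a b ab.
- by move=> x /[!in_itv]/= /andP[/ltW h1 /ltW h2]; apply H; rewrite h1.
- apply: derivable_within_continuous => x /[!in_itv]/= xab.
  by have [[]] := H x xab.
rewrite normrM (ger0_norm (_ : 0 <= b - a)) ?subr_ge0// ler_wpM2r ?subr_ge0//.
by move: cab; rewrite in_itv/= => /H[].
Qed.

(** The mean value theorem fails for plane curves but holds for each component; the factor 2 is the
    price of adding the two bounds. *)
Lemma curve_bound g (dg : R -> C) (a b M : R) : a <= b ->
  (forall s, a <= s <= b -> cderive g s (dg s) /\ `|dg s| <= M%:C) ->
  `|g b - g a| <= (2 * M * (b - a))%:C.
Proof.
move=> ab H; apply: (le_trans (norm_Re_Im _)).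
rewrite lecR -mulrA mulr_natl mulr2n creD creN cimD cimN; apply: lerD.
  apply: (@mean_value_bound (fun s => Re (g s)) (fun s => Re (dg s))) => // s /H[[? _]
    ?]; split => //.
  rewrite -lecR; exact: le_trans (normc_ge_Re _) _.
apply: (@mean_value_bound (fun s => Im (g s)) (fun s => Im (dg s))) => // s /H[[_ ?] ?];
  split => //.
rewrite -lecR; exact: le_trans (normc_ge_Im _) _.
Qed.

Lemma curve_cst g (a b : R) : a <= b ->
  (forall s, a <= s <= b -> cderive g s 0) -> g b = g a.
Proof.
move=> ab H; apply/eqP; rewrite -subr_eq0 -normr_le0.
have := @curve_bound g (fun=> 0) a b 0 ab; rewrite mulr0 mul0r; apply => s /H h;
  split => //.
by rewrite normr0.
Qed.

Lemma Cexp_derive g t d : cderive g t d ->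
  cderive (fun s => Cexp (g s)) t (Cexp (g t) * d).
Proof.
move=> [g1 g2]; rewrite /Cexp; split; rewrite ?creM ?cimM /=.
  have e := is_derive1_comp (is_derive_expR _) g1.
  have s := is_derive1_comp (is_derive_cos _) g2.
  by have := is_derive_prod e s; congr is_derive => /=; ring.
have e := is_derive1_comp (is_derive_expR _) g1.
have s := is_derive1_comp (is_derive_sin _) g2.
by have := is_derive_prod e s; congr is_derive => /=; ring.
Qed.

End Curves.

(** * Antiderivatives of continuous plane curves *)

Section Antiderivative.
Variable R : realType.
Local Notation C := (Cplx R).
Local Notation Re := complex.Re.
Local Notation Im := complex.Im.

(** Integrating from the left end of the window gives the derivative on both sides of 0; subtracting
    the value at 0 normalises the primitives, so that those of different windows agree. *)
Lemma antiderivative_window (f : R -> R) (n : nat) : continuous f ->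
  exists F : R -> R, F 0 = 0 /\
    forall x, `|x| < n.+1%:R -> is_derive x (1 : R) F (f x).
Proof.
move=> cf; pose a : R := - n.+1%:R.
pose F x := (\int[@lebesgue_measure R]_(t in [set` `[a, x]]) f t)%R.
exists (fun x => F x - F 0); split; first by rewrite subrr.
move=> x; rewrite ltr_norml => /andP[ax _].
have fi u : (@lebesgue_measure R).-integrable `[a, u] (EFin \o f).
  apply: continuous_compact_integrable; first exact: segment_compact.
  exact: continuous_subspaceT.
have [] := @continuous_FTC1_closed R f a x (x + 1) _ (fi _) ax (cf x).
  by rewrite ltrDl.
rewrite derive1E => dF F'.
rewrite -[f x]subr0; apply: is_deriveB.
by rewrite -F'; exact: derivableP.
Qed.

Lemma antiderivative_unique (F G f : R -> R) (x : R) :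
  (forall t, `|t| <= `|x| -> is_derive t (1 : R) F (f t)) ->
  (forall t, `|t| <= `|x| -> is_derive t (1 : R) G (f t)) ->
  F 0 = 0 -> G 0 = 0 -> F x = G x.
Proof.
move=> dF dG F0 G0.
have H t : `|t| <= `|x| -> is_derive t (1 : R) (fun s => F s - G s) 0.
  by move=> tx; rewrite -(subrr (f t)); apply: is_deriveB; [exact: dF|exact: dG].
suff : F x - G x = 0 by move/eqP; rewrite subr_eq0 => /eqP.
have [x0|x0] := leP 0 x.
  have := @mean_value_bound _ (fun s => F s - G s) (fun=> 0) 0 x 0 x0 _.
  rewrite F0 G0 !subr0 mul0r => h; apply/eqP; rewrite -normr_le0; apply: h.
  move=> s /andP[s0 sx]; split; last by rewrite normr0.
  by apply: H; rewrite !ger0_norm.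
have := @mean_value_bound _ (fun s => F s - G s) (fun=> 0) x 0 0 (ltW x0) _.
rewrite F0 G0 subrr sub0r normrN mul0r => h; apply/eqP; rewrite -normr_le0; apply: h.
move=> s /andP[xs s0]; split; last by rewrite normr0.
by apply: H; rewrite !ler0_norm ?lerN2// ltW.
Qed.

Lemma antiderivative_exists (f : R -> R) : continuous f ->
  exists F : R -> R, forall x, is_derive x (1 : R) F (f x).
Proof.
move=> cf; have [G HG] := choice (fun n => antiderivative_window n cf).
pose N (x : R) := Num.bound `|x|.
exists (fun x => G (N x) x) => x.
apply: (@is_derive_near _ (G (N x))); last first.
  by apply (HG _).2; rewrite (lt_trans (archi_boundP (normr_ge0 x)))// ltr_nat.
have lt_bound y : `|y| < (N y).+1%:R.
  by rewrite (lt_trans (archi_boundP (normr_ge0 y)))// ltr_nat.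
(* The index [N y] varies with y. Near x the fixed window of index [N x] also contains y, and
   uniqueness identifies the two values. *)
have : \forall y \near x, `|y| < (N x).+1%:R.
  have idx : (fun y : R => y) @ x --> x by exact: cvg_id.
  exact: (cvgr_norm_lt x idx _ (lt_bound x)).
apply: filterS => y yx.
apply: (antiderivative_unique _ _ (HG _).1 (HG _).1) => t ty.
  by apply (HG _).2; exact: le_lt_trans ty _.
by apply (HG _).2; exact: le_lt_trans ty _.
Qed.

Lemma curve_antiderivative (g : R -> C) : continuous g ->
  exists G : R -> C, forall t, cderive G t (g t).
Proof.
move=> cg.
have [|A hA] := @antiderivative_exists (fun t => Re (g t)).
  by move=> t; exact: (cvg_Re (cg t)).
have [|B hB] := @antiderivative_exists (fun t => Im (g t)).
  by move=> t; exact: (cvg_Im (cg t)).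
by exists (fun t => A t +i* B t) => t; split; [exact: hA|exact: hB].
Qed.

(* The value is irrelevant unless the curve is continuous. *)
Definition prim (g : R -> C) : R -> C :=
  xget (fun=> 0) [set G | forall t, cderive G t (g t)].

Lemma primP (g : R -> C) : continuous g -> forall t, cderive (prim g) t (g t).
Proof.
by move=> /curve_antiderivative[G hG]; rewrite /prim; case: xgetP => [_ -> //|/(_ G)[]].
Qed.

Lemma FTC2 (g G : R -> C) (a b : R) : continuous g -> a <= b ->
  (forall t, a <= t <= b -> cderive G t (g t)) ->
  prim g b - prim g a = G b - G a.
Proof.
move=> cg ab dG.
have h : prim g b - G b = prim g a - G a.
  apply: (@curve_cst R (fun s => prim g s - G s)) => // s /dG dGs.
  rewrite -(subrr (g s)).
  by apply: cderiveD; [exact: primP|exact: cderiveN].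
by rewrite -[prim g b](subrK (G b)) h; ring.
Qed.

End Antiderivative.

(** * Goursat's lemma and local primitives *)

Section Bisection.
Variable R : realType.

(** The left ends increase and stay below every right end, so their supremum lies in all the
    segments. *)
Lemma nested_segments (x s : nat -> R) : (forall n, 0 <= s n) ->
  (forall n, x n <= x n.+1) -> (forall n, x n.+1 + s n.+1 <= x n + s n) ->
  exists p, forall n, x n <= p <= x n + s n.
Proof.
move=> s0 xle xsle.
have xmono m n : (m <= n)%N -> x m <= x n.
  exact: (homo_leq (r := fun a b => a <= b) _ le_trans xle).
have xsmono m n : (m <= n)%N -> x n + s n <= x m + s m.
  apply: (homo_leq (r := fun a b => b <= a) _ _ xsle) => // a b c ab bc.
  exact: le_trans bc ab.
have ub n : ubound (range x) (x n + s n).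
  move=> _ [m _ <-]; have [mn|/ltnW nm] := leqP m n.
    by rewrite (le_trans (xmono _ _ mn))// lerDl.
  by rewrite (le_trans _ (xsmono _ _ nm))// lerDl.
exists (sup (range x)) => n; apply/andP; split.
  apply: ub_le_sup; last by exists n.
  by exists (x 0%N + s 0%N); exact: ub.
by apply: (ge_sup _ (ub n)); exists (x 0%N), 0%N.
Qed.

Lemma exists_half_pow_lt (e : R) : 0 < e -> exists n : nat, 2^-1 ^+ n < e.
Proof.
move=> e0; pose n := Num.bound e^-1; exists n.
have ei : 0 <= e^-1 by rewrite invr_ge0 ltW.
rewrite exprVn -[e]invrK ltf_pV2 ?posrE ?exprn_gt0 ?invr_gt0//.
rewrite (lt_trans (archi_boundP ei))//.
by rewrite -natrX ltr_nat ltn_expl.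
Qed.

(* A form of Cousin's lemma. *)
Lemma square_bisection (P : R -> R -> R -> Prop) :
  (forall x y s, 0 < s -> P x y (s / 2) -> P (x + s / 2) y (s / 2) ->
    P x (y + s / 2) (s / 2) -> P (x + s / 2) (y + s / 2) (s / 2) -> P x y s) ->
  (forall p q, 0 <= p <= 1 -> 0 <= q <= 1 -> exists2 e, 0 < e &
    forall x y s, 0 < s < e -> x <= p <= x + s -> y <= q <= y + s ->
      P x y s) ->
  P 0 0 1.
Proof.
move=> Pquarter Plocal; apply: contrapT => nP.
pose s (n : nat) : R := 2^-1 ^+ n.
have s0 n : 0 < s n by rewrite exprn_gt0// invr_gt0.
have sS n : s n.+1 = s n / 2 by rewrite /s exprSr.
(* The failure of [P] is a premise inside the existential, so that [choice] gives a total function,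
   which picks a failing quarter of any failing square. *)
have step (a : nat * (R * R)) : exists b : R * R, ~ P a.2.1 a.2.2 (s a.1) ->
    [/\ b.1 = a.2.1 \/ b.1 = a.2.1 + s a.1.+1,
        b.2 = a.2.2 \/ b.2 = a.2.2 + s a.1.+1 & ~ P b.1 b.2 (s a.1.+1)].
  case: a => n [x y] /=; rewrite sS.
  have [?|Pxy] := pselect (P x y (s n)); first by exists (x, y).
  have [h1|h1] := pselect (P x y (s n / 2)); last first.
    by exists (x, y) => _; split => //=; left.
  have [h2|h2] := pselect (P (x + s n / 2) y (s n / 2)); last first.
    by exists (x + s n / 2, y) => _; split => //=; [right|left].
  have [h3|h3] := pselect (P x (y + s n / 2) (s n / 2)); last first.
    by exists (x, y + s n / 2) => _; split => //=; [left|right].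
  have [h4|h4] := pselect (P (x + s n / 2) (y + s n / 2) (s n / 2)); last first.
    by exists (x + s n / 2, y + s n / 2) => _; split => //=; right.
  by exfalso; apply: Pxy; exact: Pquarter.
have [phi Hphi] := choice step.
pose u := fix u n := if n is m.+1 then phi (m, u m) else (0, 0).
have uP n : ~ P (u n).1 (u n).2 (s n).
  elim: n => [|n IH]; first by rewrite /s expr0.
  by have [] := Hphi (n, u n) IH.
have u1 n : (u n.+1).1 = (u n).1 \/ (u n.+1).1 = (u n).1 + s n.+1.
  by have [] := Hphi (n, u n) (uP n).
have u2 n : (u n.+1).2 = (u n).2 \/ (u n.+1).2 = (u n).2 + s n.+1.
  by have [] := Hphi (n, u n) (uP n).
have sle n : s n.+1 <= s n by rewrite sS; have := s0 n; lra.
have ss n : s n.+1 + s n.+1 = s n by rewrite sS -splitr.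
have [p Hp] : exists p, forall n, (u n).1 <= p <= (u n).1 + s n.
  apply: nested_segments => n; first exact: ltW.
    by have := s0 n.+1; case: (u1 n) => ->; lra.
  by have := s0 n.+1; have := ss n; case: (u1 n) => ->; lra.
have [q Hq] : exists q, forall n, (u n).2 <= q <= (u n).2 + s n.
  apply: nested_segments => n; first exact: ltW.
    by have := s0 n.+1; case: (u2 n) => ->; lra.
  by have := s0 n.+1; have := ss n; case: (u2 n) => ->; lra.
have p01 : 0 <= p <= 1 by have := Hp 0%N; rewrite /= /s expr0 add0r.
have q01 : 0 <= q <= 1 by have := Hq 0%N; rewrite /= /s expr0 add0r.
have [e e0 He] := Plocal p q p01 q01.
have [n sn] := exists_half_pow_lt e0.
by apply: (uP n); apply: He; rewrite ?s0.
Qed.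

End Bisection.

Lemma is_derive_eps (K : numFieldType) (f : K -> K) (z d : K) :
  (forall e : K, 0 < e -> \forall w \near z, `|f w - f z - d * (w - z)| <= e * `|w - z|) ->
  is_derive z (1 : K) f d.
Proof.
move=> H; apply/is_derive_caratheodory.
pose q w := if w == z then d else (f w - f z) / (w - z).
have qE w : w != z -> q w * (w - z) = f w - f z.
  by move=> wz; rewrite /q (negPf wz) divfK// subr_eq0.
have qz : q z = d by rewrite /q eqxx.
exists q; split; last by [].
  by move=> w; have [->|/qE//] := eqVneq w z; rewrite !subrr mulr0.
apply/(@cvgrPdist_le _ _ _ (nbhs z)) => e e0; have := H _ e0.
apply: (@filterS _ (nbhs z)) => w; rewrite qz.
have [->|wz] := eqVneq w z; first by rewrite qz !subrr normr0 => _; apply: ltW.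
by rewrite -qE// -mulrBl normrM ler_pM2r ?normr_gt0 ?subr_eq0// distrC.
Qed.

Section Goursat.
Variable R : realType.
Local Notation C := (Cplx R).
Local Notation Re := complex.Re.
Local Notation Im := complex.Im.

Lemma curve_bound_abs (g dg : R -> C) (a b M : R) :
  (forall s, `|s - a| <= `|b - a| -> cderive g s (dg s) /\ `|dg s| <= M%:C) ->
  `|g b - g a| <= (2 * M * `|b - a|)%:C.
Proof.
have [ab|ba] := leP a b => H.
  rewrite [`|b - a|]ger0_norm ?subr_ge0//; apply: (@curve_bound _ g dg _ _ M ab) => s sab.
  by apply: H; rewrite !ger0_norm; lra.
rewrite distrC [`|b - a|]ltr0_norm ?subr_lt0// opprB;
  apply: (@curve_bound _ g dg _ _ M (ltW ba)) => s sab.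
by apply: H; rewrite !ler0_norm; lra.
Qed.

Lemma is_derivec_eps (f : C -> C) (z d : C) :
  (forall e : R, 0 < e -> exists2 r : R, 0 < r & forall w, `|w - z| < r%:C ->
     `|f w - f z - d * (w - z)| <= e%:C * `|w - z|) ->
  is_derive z (1 : C) f d.
Proof.
move=> H; apply: (@is_derive_eps R[i]) => e /gt0_complexE[-> /H[r r0 h]].
by apply/nbhsC_ballP; exists r.
Qed.

Definition pt (x y : R) : C := x%:C + 'i * y%:C.

Lemma Re_pt x y : Re (pt x y) = x. Proof. by rewrite /pt creD creM /=; ring. Qed.
Lemma Im_pt x y : Im (pt x y) = y. Proof. by rewrite /pt cimD cimM /=; ring. Qed.
Lemma pt_ReIm z : pt (Re z) (Im z) = z.
Proof. by rewrite /pt -complexE. Qed.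

Lemma pt_norm x y x' y' : `|pt x y - pt x' y'| <= (`|x - x'| + `|y - y'|)%:C.
Proof. by rewrite (le_trans (norm_Re_Im _))// creD creN cimD cimN !Re_pt !Im_pt. Qed.

Lemma cderive_pt_l x y : cderive (fun t => pt t y) x 1.
Proof.
have := cderive_line ('i * y%:C) 1 x; congr cderive; apply/funext => t.
by rewrite mulr1 addrC.
Qed.

Lemma cderive_pt_r x y : cderive (fun t => pt x t) y 'i.
Proof.
have := cderive_line (x%:C) 'i y; congr cderive; apply/funext => t.
by rewrite [_ * 'i]mulrC.
Qed.

Section Rectangle.
Variable f : C -> C.
Hypothesis cf : continuous f.

(** One primitive for each whole horizontal or vertical line: integrals over sides are differences
    of its values, and all identities between subdivided contours reduce to [ring]. *)
Let hor (y : R) : R -> C := prim (fun t => f (pt t y)).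
Let ver (x : R) : R -> C := prim (fun t => f (pt x t)).

Let horP y t : cderive (hor y) t (f (pt t y)).
Proof.
apply: (primP (g := fun t => f (pt t y))) => s.
have k : {for pt s y, continuous f} by exact: cf.
exact: (continuous_comp (cderive_continuous (cderive_pt_l s y)) k).
Qed.

Let verP x t : cderive (ver x) t (f (pt x t)).
Proof.
apply: (primP (g := fun t => f (pt x t))) => s.
have k : {for pt x s, continuous f} by exact: cf.
exact: (continuous_comp (cderive_continuous (cderive_pt_r x s)) k).
Qed.

Definition rect_integral (x1 x2 y1 y2 : R) : C :=
  (hor y1 x2 - hor y1 x1) + 'i * (ver x2 y2 - ver x2 y1)
  - (hor y2 x2 - hor y2 x1) - 'i * (ver x1 y2 - ver x1 y1).

(** Near the point, f is its affine part A up to e times the distance. As A has the primitive L, it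
    contributes nothing around the closed contour, and what remains is bounded by e times the size
    of the rectangle, on sides of comparable total length. *)
Lemma rect_integral_local (x0 y0 : R) : derivable f (pt x0 y0) (1 : C) ->
  forall e : R, 0 < e -> exists2 r : R, 0 < r & forall x1 x2 y1 y2,
    x1 <= x0 <= x2 -> y1 <= y0 <= y2 -> (x2 - x1) + (y2 - y1) < r ->
    `|rect_integral x1 x2 y1 y2| <= (4 * e * ((x2 - x1) + (y2 - y1)) ^+ 2)%:C.
Proof.
move=> df e e0; pose p := pt x0 y0; pose d : C := 'D_(1:C) f p.
have /is_derivec_caratheodory[q [qE qc qd]] : is_derive p (1 : C) f d by exact: derivableP.
have /nbhsC_ballP[r r0 Hr] : \forall w \near p, `|d - q w| < e%:C.
  have qc' : q @ nbhs p --> d by rewrite -qd; exact: qc.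
  exact: ((cvgcP _ _).2 qc' e e0).
exists r => // x1 x2 y1 y2 /andP[x10 x02] /andP[y10 y02].
set D := _ + _ => Dr.
pose L (w : C) : C := f p * w + 2^-1 * d * ((w - p) * (w - p)).
pose A (w : C) : C := f p + d * (w - p).
have dL w : is_derive w (1 : C) L (A w).
  have dz : is_derive w (1 : C) (fun w : C => w - p) 1.
    have := @is_derive_affine R[i] 1 (- p) w.
    by under eq_fun do rewrite mul1r addrC.
  have d1 := @is_derive_scale R[i] _ _ _ (2^-1 * d) (@is_derive_prod R[i] _ _ _ _ _ dz dz).
  have d2 := @is_derive_affine R[i] (f p) 0 w.
  have := @is_derive_add R[i] _ _ _ _ _ d2 d1; rewrite mul1r mulr1.
  have -> : f p + 2^-1 * d * (w - p + (w - p)) = A w.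
    by rewrite /A; congr (_ + _); field.
  by under eq_fun do rewrite add0r.
have fA w : `|w - p| <= D%:C -> `|f w - A w| <= (e * D)%:C.
  move=> wD; have -> : f w - A w = (q w - d) * (w - p) by rewrite mulrBl -qE /A; ring.
  rewrite normrM rmorphM/= ler_pM// distrC ltW// Hr//.
  by apply: le_lt_trans wD _; rewrite ltcR.
(* The side primitives with the exact part removed. The values of L at the four corners cancel in
   the contour integral; in V the factor i comes from dz = i dy. *)
pose H x y := hor y x - L (pt x y).
pose V x y := 'i * ver x y - L (pt x y).
have hH y : y1 <= y <= y2 -> `|H x2 y - H x1 y| <= (2 * (e * D) * (x2 - x1))%:C.
  move=> /andP[y1y yy2].
  apply: (@curve_bound _ (fun x => H x y) (fun x => f (pt x y) - A (pt x y))); first lra.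
  move=> s /andP[s1 s2]; split.
    apply: cderiveD; first exact: horP.
    apply: cderiveN; rewrite -[A _]mulr1.
    exact: (cderive_comp (dL _) (cderive_pt_l _ _)).
  apply: fA; rewrite (le_trans (pt_norm _ _ _ _))// lecR /D lerD// ler_norml; lra.
have hV x : x1 <= x <= x2 -> `|V x y2 - V x y1| <= (2 * (e * D) * (y2 - y1))%:C.
  move=> /andP[x1x xx2].
  apply: (@curve_bound _ (fun y => V x y) (fun y => 'i * (f (pt x y) - A (pt x y))));
    first lra.
  move=> s /andP[s1 s2]; split.
    rewrite mulrBr; apply: cderiveD; first by apply: cderiveZ; exact: verP.
    apply: cderiveN; rewrite mulrC.
    exact: (cderive_comp (dL _) (cderive_pt_r _ _)).
  rewrite normrM norm_i mul1r.
  apply: fA; rewrite (le_trans (pt_norm _ _ _ _))// lecR /D lerD// ler_norml; lra.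
have -> : rect_integral x1 x2 y1 y2 = (H x2 y1 - H x1 y1) + (V x2 y2 - V x2 y1)
    - (H x2 y2 - H x1 y2) - (V x1 y2 - V x1 y1).
  by rewrite /rect_integral /H /V; ring.
have l1 := hH y1; have l2 := hH y2; have l3 := hV x1; have l4 := hV x2.
have -> : 4 * e * D ^+ 2 = (2 * (e * D) * (x2 - x1)) + (2 * (e * D) * (y2 - y1))
   + (2 * (e * D) * (x2 - x1)) + (2 * (e * D) * (y2 - y1)) by rewrite /D; ring.
rewrite (le_trans (ler_normB _ _))// [in leRHS]rmorphD lerD//; last by apply: l3; lra.
rewrite (le_trans (ler_normB _ _))// [in leRHS]rmorphD lerD//; last by apply: l2; lra.
rewrite (le_trans (ler_normD _ _))// [in leRHS]rmorphD lerD//; first by apply: l1; lra.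
by apply: l4; lra.
Qed.

Variables a1 b1 a2 b2 : R.
Hypothesis df : forall x y, a1 <= x <= b1 -> a2 <= y <= b2 -> derivable f (pt x y) (1 : C).

(** The bound proved by bisection is quadratic in the side s. Four quarters contribute four times (s
    / 2)^2 = s^2 / 4, so it passes from the quarters to the whole, while differentiability gives it
    for small squares. The rectangle is parametrised by the unit square to fit
    [square_bisection]. *)
Lemma Goursat_ordered x1 x2 y1 y2 : a1 <= x1 -> x1 <= x2 -> x2 <= b1 ->
  a2 <= y1 -> y1 <= y2 -> y2 <= b2 -> rect_integral x1 x2 y1 y2 = 0.
Proof.
move=> ax xx xb ay yy yb; pose W := x2 - x1; pose Z := y2 - y1.
have W0 : 0 <= W by rewrite subr_ge0.
have Z0 : 0 <= Z by rewrite subr_ge0.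
suff H e : 0 < e -> `|rect_integral x1 x2 y1 y2| <= (4 * e * (W + Z) ^+ 2)%:C.
  have K0 : 0 < 4 * (W + Z) ^+ 2 + 1 by rewrite ltr_wpDl// mulr_ge0// sqr_ge0.
  apply/eqP; apply: contraT; rewrite -normr_gt0 => /gt0_complexE[E J0].
  set J := Re _ in E J0.
  (* For this k the bound reads J <= J - k. The summand 1 keeps the denominator positive for a
     rectangle reduced to a point. *)
  pose k := J / (4 * (W + Z) ^+ 2 + 1).
  have k0 : 0 < k by rewrite divr_gt0.
  have Jk : J = k * (4 * (W + Z) ^+ 2 + 1) by rewrite divfK// gt_eqF.
  have := H k k0; rewrite E lecR {}Jk.
  by lra.
move=> e0.
pose P u v s := `|rect_integral (x1 + W * u) (x1 + W * (u + s)) (y1 + Z * v) (y1 + Z * (v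
  + s))|
   <= (4 * e * ((W + Z) * s) ^+ 2)%:C.
have : P 0 0 1.
  apply: (@square_bisection _ P) => [u v s s0|p q /andP[p0 p1] /andP[q0 q1]]; last first.
    have [|r r0 Hr] := @rect_integral_local (x1 + W * p) (y1 + Z * q) _ e e0.
      apply: df; rewrite /W /Z; nra.
    (* A square of side s has an image of half-perimeter (W + Z) s, which must be below r; the
       summand 1 again avoids a zero denominator. *)
    exists (r / (W + Z + 1)); first by rewrite divr_gt0//; lra.
    move=> u v s; rewrite ltr_pdivlMr; last by lra.
    move=> /andP[s0 sr] /andP[up pus] /andP[vq qvs]; rewrite /P.
    have -> : (W + Z) * s = (x1 + W * (u + s) - (x1 + W * u)) + (y1 + Z * (v + s) - (y1 +
      Z * v)) by ring.
    by apply: Hr; nra.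
  have ss : u + s / 2 + s / 2 = u + s by rewrite -addrA -splitr.
  have sv : v + s / 2 + s / 2 = v + s by rewrite -addrA -splitr.
  rewrite /P ss sv => h1 h2 h3 h4.
  have -> : 4 * e * ((W + Z) * s) ^+ 2 = 4 * e * ((W + Z) * (s / 2)) ^+ 2 +
    4 * e * ((W + Z) * (s / 2)) ^+ 2 + 4 * e * ((W + Z) * (s / 2)) ^+ 2 +
    4 * e * ((W + Z) * (s / 2)) ^+ 2 by field.
  set I1 := rect_integral _ _ _ _ in h1; set I2 := rect_integral _ _ _ _ in h2.
  set I3 := rect_integral _ _ _ _ in h3; set I4 := rect_integral _ _ _ _ in h4.
  have -> : rect_integral (x1 + W * u) (x1 + W * (u + s)) (y1 + Z * v) (y1 + Z * (v + s))
    = I1 + I2 + I3 + I4.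
    by rewrite /I1 /I2 /I3 /I4 /rect_integral; ring.
  rewrite !rmorphD/= (le_trans (ler_normD _ _))// lerD//.
  by rewrite (le_trans (ler_normD _ _))// lerD// (le_trans (ler_normD _ _))// lerD.
by rewrite /P !mulr0 !addr0 !add0r !mulr1 /W /Z !subrKC.
Qed.
Lemma Goursat x1 x2 y1 y2 : a1 <= x1 <= b1 -> a1 <= x2 <= b1 ->
  a2 <= y1 <= b2 -> a2 <= y2 <= b2 -> rect_integral x1 x2 y1 y2 = 0.
Proof.
wlog xx : x1 x2 / x1 <= x2.
  move=> H; have [/H//|/ltW/H {}H h1 h2 h3 h4] := leP x1 x2.
  by rewrite -[LHS]opprK -[RHS]oppr0 -(H h2 h1 h3 h4) /rect_integral; congr (- _); ring.
wlog yy : y1 y2 / y1 <= y2.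
  move=> H; have [/H//|/ltW/H {}H h1 h2 h3 h4] := leP y1 y2.
  by rewrite -[LHS]opprK -[RHS]oppr0 -(H h1 h2 h4 h3) /rect_integral; congr (- _); ring.
by move=> /andP[? ?] /andP[? ?] /andP[? ?] /andP[? ?]; exact: Goursat_ordered.
Qed.

(** F integrates along the bottom side and then vertically. Goursat moves the horizontal part of an
    increment up to the height of the point, where f is close to its value there; continuity of f
    then gives the derivative. *)
Lemma rect_primitive : exists F : C -> C, forall x y, a1 < x < b1 -> a2 < y < b2 ->
  is_derive (pt x y) (1 : C) F (f (pt x y)).
Proof.
exists (fun z => hor a2 (Re z) - hor a2 a1 + 'i * (ver (Re z) (Im z) - ver (Re z) a2)).
move=> x y /andP[ax xb] /andP[ay yb]; apply: is_derivec_eps => e e0.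
set z := pt x y.
(* One factor 2 is lost in [curve_bound_abs], another in bounding the sum of the two coordinate
   increments by twice the norm. *)
have e4 : 0 < e / 4 by rewrite divr_gt0.
have /nbhsC_ballP[r1 r10 Hr1] : \forall w \near z, `|f z - f w| < (e / 4)%:C.
  have cfz : f @ nbhs z --> f z by exact: cf.
  exact: ((cvgcP _ _).2 cfz _ e4).
(* Half of r1, since distances are bounded by the sum of two coordinate increments; the other terms
   keep w inside the rectangle. *)
pose r := Num.min (r1 / 2) (Num.min (Num.min (x - a1) (b1 - x)) (Num.min (y - a2) (b2 -
  y))).
exists r; first by rewrite !lt_min divr_gt0// !subr_gt0 ax xb ay yb.
move=> w; set x' := Re w; set y' := Im w => wr.
have wE : w = pt x' y' by rewrite pt_ReIm.
have wzE : w - z = (x' - x)%:C + 'i * (y' - y)%:C.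
  by rewrite wE /z /pt !rmorphB; ring.
have xw : `|x' - x|%:C <= `|w - z|.
  by have := normc_ge_Re (w - z); rewrite creD creN Re_pt.
have yw : `|y' - y|%:C <= `|w - z|.
  by have := normc_ge_Im (w - z); rewrite cimD cimN Im_pt.
have [xr yr] : `|x' - x| < r /\ `|y' - y| < r.
  by split; rewrite -ltcR; [exact: le_lt_trans xw wr|exact: le_lt_trans yw wr].
move: xr yr; rewrite !lt_min => /andP[xr /andP[+ _]] /andP[yr /andP[_ +]].
rewrite -!lt_min !lt_min !ltr_norml => /andP[/andP[xl1 xl2] /andP[xl3 xl4]]
  /andP[/andP[yl1 yl2] /andP[yl3 yl4]].
(* This replaces the horizontal leg at height a2 by the one at height y. The terms of the form 0 + t
   f(z) below have the shape of [cderive_line]: they subtract the constant value f(z) along each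
   leg. *)
have G : rect_integral x x' a2 y = 0 by apply: Goursat; lra.
have -> : hor a2 x' - hor a2 a1 + 'i * (ver x' y' - ver x' a2)
   - (hor a2 (Re z) - hor a2 a1 + 'i * (ver (Re z) (Im z) - ver (Re z) a2))
   - f z * (w - z) = ((hor y x' - (0 + x'%:C * f z)) - (hor y x - (0 + x%:C * f z)))
   + 'i * ((ver x' y' - (0 + y'%:C * f z)) - (ver x' y - (0 + y%:C * f z))).
  rewrite Re_pt Im_pt wzE !rmorphB; move: G;
    rewrite /rect_integral -/(hor _) -/(ver _) => G.
  by rewrite -[RHS]addr0 -[X in _ = _ + X]G /hor /ver; ring.
have near_f s t : `|s - x| <= `|x' - x| -> `|t - y| <= `|y' - y| ->
    `|f (pt s t) - f z| <= (e / 4)%:C.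
  move=> sx ty; rewrite distrC ltW//; apply: Hr1.
  by rewrite (le_lt_trans (pt_norm _ _ _ _))// ltcR; lra.
have hh : `|(hor y x' - (0 + x'%:C * f z)) - (hor y x - (0 + x%:C * f z))| <= (2 * (e /
  4) * `|x' - x|)%:C.
  apply: (@curve_bound_abs (fun s => hor y s - (0 + s%:C * f z)) (fun s => f (pt s y) - f
    z)) => s sx.
  split; first by apply: cderiveD; [exact: horP|exact/cderiveN/cderive_line].
  by apply: near_f; rewrite // subrr normr0.
have hv : `|(ver x' y' - (0 + y'%:C * f z)) - (ver x' y - (0 + y%:C * f z))| <= (2 * (e /
  4) * `|y' - y|)%:C.
  apply: (@curve_bound_abs (fun s => ver x' s - (0 + s%:C * f z)) (fun s => f (pt x' s) -
    f z)) => s sy.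
  split; first by apply: cderiveD; [exact: verP|exact/cderiveN/cderive_line].
  exact: near_f.
rewrite (le_trans (ler_normD _ _))// normrM norm_i mul1r.
rewrite (le_trans (lerD hh hv))// -rmorphD/= -mulrDr.
have -> : 2 * (e / 4) = e * 2^-1 by field.
rewrite -mulrA rmorphM/= ler_pM2l ?ltcR//.
have : ((`|x' - x| + `|y' - y|)%:C : R[i]) <= 2 * `|w - z|.
  by rewrite rmorphD mulr_natl mulr2n lerD.
by rewrite rmorphM/= fmorphV rmorph_nat ler_pdivrMl.
Qed.
End Rectangle.

(** The retraction of the line onto [-k, k], obtained from [clamp] by an affine change of
    variable. *)
Let cl (k t : R) := 2 * k * clamp ((t + k) / (2 * k)) - k.

Let cl_bound k t : 0 < k -> `|cl k t| <= k.
Proof. by move=> k0; have /andP[? ?] := clampP ((t + k) / (2 * k));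
  rewrite /cl ler_norml; nra. Qed.

Let cl_id k t : 0 < k -> `|t| <= k -> cl k t = t.
Proof.
move=> k0; rewrite ler_norml => /andP[tk kt]; rewrite /cl clamp_id; first by field; lra.
rewrite divr_ge0 ?ler_pdivrMr; lra.
Qed.

Let cl_continuous k : continuous (cl k).
Proof.
move=> t; apply: cvgB; last exact: cvg_cst.
apply: cvgM; first exact: cvg_cst.
have h : {for t, continuous (fun t => (t + k) / (2 * k))}.
  apply: cvgM; last exact: cvg_cst.
  by apply: cvgD; [exact: cvg_id|exact: cvg_cst].
have cc : {for (t + k) / (2 * k), continuous (@clamp R)} by exact: continuous_clamp.
exact: (continuous_comp h cc).
Qed.

(** [rect_primitive] assumes continuity on the whole plane, because [prim] is meaningful only for
    curves continuous on the whole line. The square of half-side k = r / 4 lies in the disc of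
    radius r where f is differentiable, so f can be composed with a retraction onto it. *)
Lemma holomorphic_primitive (f : C -> C) (z0 : C) :
  (\forall z \near z0, derivable f z (1 : C)) ->
  exists F : C -> C, \forall z \near z0, is_derive z (1 : C) F (f z).
Proof.
move=> /nbhsC_ballP[r r0 df].
pose k := r / 4; have k0 : 0 < k by rewrite divr_gt0.
(* Composing with a retraction onto a square makes [f] continuous everywhere. *)
pose rho (z : C) : C := pt (Re z0 + cl k (Re z - Re z0)) (Im z0 + cl k (Im z - Im z0)).
have rho_ball z : `|rho z - z0| < r%:C.
  rewrite -[z0 in X in X < _]pt_ReIm (le_lt_trans (pt_norm _ _ _ _))// ltcR.
  have h1 := cl_bound (Re z - Re z0) k0; have h2 := cl_bound (Im z - Im z0) k0.
  by rewrite addrAC subrr add0r addrAC subrr add0r; move: h1 h2; rewrite /k; lra.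
have rho_id z : `|Re z - Re z0| <= k -> `|Im z - Im z0| <= k -> rho z = z.
  by move=> h1 h2; rewrite /rho !cl_id// !subrKC pt_ReIm.
have crho : continuous rho.
  move=> z; apply: (@cvg_RI _ _ (nbhs z)).
    rewrite [in X in _ --> X]Re_pt; under eq_fun do rewrite Re_pt.
    apply: cvgD; first exact: cvg_cst.
    have h : {for z, continuous (fun w : C => Re w - Re z0)}.
      by have cr := @continuous_Re R z; exact: (cvgB cr (cvg_cst _)).
    have k1 : {for Re z - Re z0, continuous (cl k)} by exact: cl_continuous.
    exact: (continuous_comp h k1).
  rewrite [in X in _ --> X]Im_pt; under eq_fun do rewrite Im_pt.
  apply: cvgD; first exact: cvg_cst.
  have h : {for z, continuous (fun w : C => Im w - Im z0)}.
    by have cr := @continuous_Im R z; exact: (cvgB cr (cvg_cst _)).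
  have k1 : {for Im z - Im z0, continuous (cl k)} by exact: cl_continuous.
  exact: (continuous_comp h k1).
have cf : continuous (f \o rho).
  move=> z; apply: (@continuous_comp _ _ _ rho f); first exact: crho.
  have /derivable1_diffP := df _ (rho_ball z).
  exact: differentiable_continuous.
(* Differentiability of g is inherited from f only where the two agree on a neighbourhood, hence the
   strictly smaller square of half-side l. *)
pose g := f \o rho; pose l := k / 2.
have lk : l < k by rewrite /l; lra.
have [|F HF] := @rect_primitive g cf (Re z0 - l) (Re z0 + l) (Im z0 - l) (Im z0 + l).
  move=> x y /andP[x1 x2] /andP[y1 y2].
  have rr : `|x - Re z0| < k /\ `|y - Im z0| < k by rewrite !ltr_norml; lra.
  have near_id : \forall w \near pt x y, f w = g w.
    apply/nbhsC_ballP; exists (k - l) => [|w wp]; first by rewrite subr_gt0.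
    have wx : `|Re w - x| < k - l.
      rewrite -ltcR; apply: le_lt_trans wp; have := normc_ge_Re (w - pt x y).
      by rewrite creD creN Re_pt.
    have wy : `|Im w - y| < k - l.
      rewrite -ltcR; apply: le_lt_trans wp; have := normc_ge_Im (w - pt x y).
      by rewrite cimD cimN Im_pt.
    by rewrite /g /= rho_id// ler_norml; move: wx wy; rewrite !ltr_norml; lra.
  apply: (@near_eq_derivable R[i] C C _ _ _ _ near_id); apply: df.
  have := rho_ball (pt x y); rewrite rho_id// ?Re_pt ?Im_pt; apply: ltW;
    [exact: rr.1|exact: rr.2].
exists F; apply/nbhsC_ballP; exists l => [|z zl]; first by rewrite divr_gt0.
have zx : `|Re z - Re z0| < l.
  by rewrite -ltcR -creN -creD; exact: le_lt_trans (normc_ge_Re _) zl.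
have zy : `|Im z - Im z0| < l.
  by rewrite -ltcR -cimN -cimD; exact: le_lt_trans (normc_ge_Im _) zl.
have E : rho z = z.
  by apply: rho_id; apply: ltW; [exact: lt_trans zx lk|exact: lt_trans zy lk].
have := HF (Re z) (Im z); rewrite pt_ReIm /g [(f \o rho) z]/= E; apply.
  by move: zx; rewrite ltr_norml; lra.
by move: zy; rewrite ltr_norml; lra.
Qed.


End Goursat.

(** * Cauchy's integral formula *)

Section CauchyFormula.
Variable R : realType.
Local Notation C := (Cplx R).
Local Notation Re := complex.Re.
Local Notation Im := complex.Im.

Definition integral01 (g : R -> C) : C := prim g 1 - prim g 0.

Lemma integral01_FTC (g G : R -> C) : continuous g ->
  (forall t, cderive G t (g t)) -> integral01 g = G 1 - G 0.
Proof. by move=> cg dG; apply: FTC2 => // t _; exact: dG. Qed.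

Lemma integral01_scale (g : R -> C) (a : C) : continuous g ->
  integral01 (fun t => a * g t) = a * integral01 g.
Proof.
move=> cg; rewrite /integral01 mulrBr.
apply: (@integral01_FTC (fun t => a * g t) (fun t => a * prim g t)).
  by move=> t; apply: continuous_mulc; [exact: cst_continuous|exact: cg].
by move=> t; apply: cderiveZ; exact: primP.
Qed.

(** Compactness of [0, 1] makes [H'] uniformly close to its value at z0. The mean value inequality
    is used twice: along the segment from z0 to w for each t, then in t on the primitives. *)
Lemma derive_under_integral (H H' : C -> R -> C) (z0 : C) (r : R) : 0 < r ->
  (forall z, `|z - z0| < r%:C -> continuous (H z)) ->
  (forall z t, `|z - z0| < r%:C -> is_derive z (1 : C) (H^~ t) (H' z t)) ->
  continuous (H' z0) ->
  (forall t, {for (t, z0), continuous (fun p : R * C => H' p.2 p.1)}) ->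
  is_derive z0 (1 : C) (fun z => integral01 (H z)) (integral01 (H' z0)).
Proof.
move=> r0 cH dH cH'0 cH'; apply: is_derivec_eps => e e0.
(* Each of the two mean value inequalities costs a factor 2. The further halving serves a comparison
   through the value of [H' z0] at t. *)
have e4 : 0 < e / 4 by rewrite divr_gt0.
have e8 : 0 < e / 4 / 2 by rewrite divr_gt0.
have : \forall z \near z0, `[0, 1]%classic `<=` (fun t => `|H' z t - H' z0 t| <= (e /
  4)%:C).
  have /compact_near_coveringP : compact (`[0, 1]%classic : set R) by exact:
    segment_compact.
  move/(_ C (nbhs z0) (fun z t => `|H' z t - H' z0 t| <= (e / 4)%:C)); apply => t _.
  have c1 : (fun p : R * C => H' p.2 p.1) @ nbhs (t, z0) --> H' z0 t by exact: cH'.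
  have := (cvgcP _ _).2 c1 _ e8.
  have c2 : (H' z0) @ nbhs t --> H' z0 t by exact: cH'0.
  have := (cvgcP _ _).2 c2 _ e8.
  move=> h2 [[A B] [/= nA nB] AB].
  exists (A `&` [set s | `|H' z0 t - H' z0 s| < (e / 4 / 2)%:C], B).
    by split => /=; [apply: filterI; [exact: nA|exact: h2]|exact: nB].
  move=> [s z] [/= [As hs] Bz] /=.
  rewrite -(subrKA (H' z0 t)) (le_trans (ler_normD _ _))//.
  rewrite [e / 4]splitr rmorphD lerD// ltW//; rewrite distrC.
  exact: (AB (s, z)).
move=> /nbhsC_ballP[r1 r10 Hr1].
exists (Num.min r r1); first by rewrite lt_min r0.
move=> w wr.
have [N N0 wN] : exists2 N : R, 0 <= N & `|w - z0| = N%:C.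
  have : 0 <= `|w - z0| by []. 
  by rewrite normc_def lecR => ?; eexists; last reflexivity.
move: wr; rewrite wN ltcR lt_min => /andP[Nr Nr1].
have bnd t : 0 <= t <= 1 -> `|H w t - H z0 t - H' z0 t * (w - z0)| <= (2 * (e / 4 * N))%:C.
  move=> t01.
  (* The difference is the variation, from parameter 0 to 1, of a curve along the segment from z0 to
     w; the linear term has the shape of [cderive_line]. *)
  have -> : H w t - H z0 t - H' z0 t * (w - z0) =
    (H (z0 + 1%:C * (w - z0)) t - (0 + 1%:C * (H' z0 t * (w - z0))))
    - (H (z0 + 0%:C * (w - z0)) t - (0 + 0%:C * (H' z0 t * (w - z0)))).
    by rewrite !mul1r !mul0r !addr0 add0r subr0 subrKC; ring.
  have -> : 2 * (e / 4 * N) = 2 * (e / 4 * N) * (1 - 0) by rewrite subr0 mulr1.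
  apply: (@curve_bound R (fun s => H (z0 + s%:C * (w - z0)) t - (0 + s%:C * (H' z0 t * (w
    - z0))))
    (fun s => (H' (z0 + s%:C * (w - z0)) t - H' z0 t) * (w - z0))) => //.
  move=> s /andP[s0 s1].
  have sN : `|z0 + s%:C * (w - z0) - z0| = (s * N)%:C.
    by rewrite addrAC subrr add0r normrM wN norm_realc ger0_norm// rmorphM.
  have sNN : s * N <= N by rewrite ler_piMl.
  split.
    rewrite mulrBl; apply: cderiveD; last exact/cderiveN/cderive_line.
    apply: (cderive_comp (f := H^~ t) _ (cderive_line _ _ _)).
    by apply: dH; rewrite sN ltcR (le_lt_trans sNN).
  rewrite normrM wN rmorphM ler_pM//; first by rewrite lecR.
  apply: (Hr1 (z0 + s%:C * (w - z0))); last by rewrite /= in_itv.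
  by rewrite sN ltcR (le_lt_trans sNN).
have -> : integral01 (H w) - integral01 (H z0) - integral01 (H' z0) * (w - z0) =
  (prim (H w) 1 - prim (H z0) 1 - (w - z0) * prim (H' z0) 1) -
  (prim (H w) 0 - prim (H z0) 0 - (w - z0) * prim (H' z0) 0).
  by rewrite /integral01; ring.
have -> : e%:C * N%:C = (2 * (2 * (e / 4 * N)) * (1 - 0))%:C.
  by rewrite -rmorphM; congr (_%:C); field.
apply: (@curve_bound R (fun t => prim (H w) t - prim (H z0) t - (w - z0) * prim (H' z0) t)
  (fun t => H w t - H z0 t - H' z0 t * (w - z0))) => // t t01; split; last exact: bnd.
apply: cderiveD; last by rewrite mulrC; apply/cderiveN/cderiveZ; exact: primP.
apply: cderiveD; first by apply: primP; apply: cH; rewrite wN ltcR.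
by apply/cderiveN/primP; apply: cH; rewrite subrr normr0 ltcR.
Qed.
End CauchyFormula.

(** With the factorial included, differentiating the kernel with respect to its pole merely raises m
    by one. *)
Lemma inv_pow_derive (K : numFieldType) (m : nat) (z x : K) : z - x != 0 ->
  is_derive x (1 : K) (fun w => m`!%:R * (z - w)^-1 ^+ m.+1)
    (m.+1`!%:R * (z - x)^-1 ^+ m.+2).
Proof.
move=> zx.
have d0 : is_derive x (1 : K) (fun w => z - w) (-1).
  by have := is_derive_affine (-1) z x; under eq_fun do rewrite mulN1r.
have d1 := is_deriveX m.+1 (@is_derive_inv K (fun w => z - w) x _ zx d0).
have := is_derive_scale m`!%:R d1; congr is_derive.
 by apply/funext => w; rewrite exprfctE.
rewrite opprK /GRing.scale /= factS natrM !exprS expr0 mulr1 div1r invfM.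
by field.
Qed.

Section Circle.
Variable R : realType.
Local Notation C := (Cplx R).
Local Notation Re := complex.Re.
Local Notation Im := complex.Im.

Lemma norm_Cexp (z : C) : `|Cexp z| = (expR (Re z))%:C.
Proof.
rewrite normc_def /= !exprMn -mulrDr cos2Dsin2 mulr1 sqrtr_sqr.
by rewrite ger0_norm// expR_ge0.
Qed.

Definition two_pi_i : C := 0 +i* (2 * pi).
Local Notation T := two_pi_i.
Let U (t : R) : C := Cexp (0 + t%:C * T).

Variables (a0 : C) (rho : R).
Hypothesis rho0 : 0 < rho.

Definition circle (t : R) : C := a0 + rho%:C * U t.
Definition dcircle (t : R) : C := (circle t - a0) * T.

Lemma cderive_circle t : cderive circle t (dcircle t).
Proof.
have := cderiveD (cderive_cst a0 t) (cderiveZ rho%:C (Cexp_derive (cderive_line 0 T t))).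
by rewrite add0r /dcircle /circle (addrC a0) addrK mulrA.
Qed.

Lemma norm_circle t : `|circle t - a0| = rho%:C.
Proof.
rewrite /circle addrAC subrr add0r normrM norm_Cexp norm_realc gtr0_norm//.
by rewrite creD creM /= !mul0r mulr0 subr0 addr0 expR0 mulr1.
Qed.

Lemma circle_neq a t : `|a - a0| < rho%:C -> circle t - a != 0.
Proof. by apply: contraTneq => /eqP; rewrite subr_eq0 => /eqP <-;
  rewrite norm_circle ltxx. Qed.

Lemma circle_closed : circle 1 = circle 0.
Proof.
rewrite /circle; congr (_ + _ * _); rewrite /U /Cexp.
have -> : Re (0 + 1%:C * T) = 0 by rewrite creD creM /=; ring.
have -> : Im (0 + 1%:C * T) = pi *+ 2 by rewrite cimD cimM /= -mulr_natl; ring.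
have -> : Re (0 + 0%:C * T) = 0 by rewrite creD creM /=; ring.
have -> : Im (0 + 0%:C * T) = 0 by rewrite cimD cimM /=; ring.
by rewrite cos2pi sin2pi cos0 sin0.
Qed.

Lemma continuous_circle : continuous circle.
Proof. by move=> t; exact: cderive_continuous (cderive_circle t). Qed.

Lemma continuous_dcircle : continuous dcircle.
Proof.
move=> t; have h : {for t, continuous (fun s => circle s - a0)}.
  by apply: continuous_addc; [exact: continuous_circle|exact: cst_continuous].
have h' : {for t, continuous (fun _ : R => T)} by exact: cst_continuous.
exact: (continuous_mulc h h').
Qed.

Lemma two_pi_i_neq0 : T != 0.
Proof. by rewrite eq_complex /= negb_and mulf_neq0 ?orbT// gt_eqF// pi_gt0. Qed.

(** The weight [g] is meant to contain the velocity of the circle: for g = F(circle) [dcircle] the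
    integral of the kernel over [0, 1] is 2 pi i times the m-th derivative of F at a. *)
Definition cauchy_kernel (m : nat) (g : R -> C) (a : C) (t : R) : C :=
  g t * (m`!%:R * (circle t - a)^-1 ^+ m.+1).

Lemma continuous_invc (S : topologicalType) (g : S -> C) (s : S) : g s != 0 ->
  {for s, continuous g} -> {for s, continuous (fun x => (g x)^-1)}.
Proof. exact: (@continuousV R[i]). Qed.

Lemma continuous_expc (S : topologicalType) (g : S -> C) (s : S) m :
  {for s, continuous g} -> {for s, continuous (fun x => g x ^+ m)}.
Proof.
move=> cg; elim: m => [|m IH]; first exact: cst_continuous.
have -> : (fun x => g x ^+ m.+1) = (fun x => g x * g x ^+ m).
  by apply/funext => x; rewrite exprS.
exact: (continuous_mulc cg IH).
Qed.

Lemma cauchy_kernel_continuous2 m g a t : continuous g -> `|a - a0| < rho%:C ->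
  {for (t, a), continuous (fun p : R * C => cauchy_kernel m g p.2 p.1)}.
Proof.
move=> cg ar; have c1 : {for (t, a), continuous (fun p : R * C => p.1)} by exact: cvg_fst.
have c2 : {for (t, a), continuous (fun p : R * C => p.2)} by exact: cvg_snd.
apply: continuous_mulc.
  have cgt : {for t, continuous g} by exact: cg.
  exact: (@continuous_comp _ _ _ _ g _ c1 cgt).
apply: continuous_mulc; first exact: cst_continuous.
apply: continuous_expc; apply: continuous_invc; first exact: circle_neq.
apply: continuous_addc; last exact: (@continuousN R[i] C).
have cct : {for t, continuous circle} by exact: continuous_circle.
exact: (@continuous_comp _ _ _ _ circle _ c1 cct).
Qed.

Lemma cauchy_kernel_continuous m g a : continuous g -> `|a - a0| < rho%:C ->
  continuous (cauchy_kernel m g a).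
Proof.
move=> cg ar t.
have c1 : {for t, continuous (fun s : R => (s, a) : R * C)}.
  exact: (@cvg_pair _ _ _ (nbhs t) _ _ _ _ _ _ _ cvg_id (cvg_cst a)).
exact: (@continuous_comp _ _ _ _ _ _ c1 (@cauchy_kernel_continuous2 m g a t cg ar)).
Qed.

Lemma cauchy_kernel_derive m g a t : `|a - a0| < rho%:C ->
  is_derive a (1 : C) (fun w => cauchy_kernel m g w t) (cauchy_kernel m.+1 g a t).
Proof.
move=> ar; apply: (@is_derive_scale R[i]).
by apply: (@inv_pow_derive R[i]); exact: circle_neq.
Qed.

Definition cauchy_integral m g a := integral01 (cauchy_kernel m g a).

Lemma cauchy_integral_derive m g a : continuous g -> `|a - a0| < rho%:C ->
  is_derive a (1 : C) (cauchy_integral m g) (cauchy_integral m.+1 g a).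
Proof.
move=> cg /[dup] ar.
rewrite -subr_gt0 => /gt0_complexE[]; set r := Re _ => rE r0.
have near_a z : `|z - a| < r%:C -> `|z - a0| < rho%:C.
  move=> zr; rewrite -(subrKA a) (le_lt_trans (ler_normD _ _))//.
  by rewrite -[ltRHS](subrK `|a - a0|) rE ltrD2r.
apply: (@derive_under_integral _ (cauchy_kernel m g) (cauchy_kernel m.+1 g) a r r0).
- by move=> z /near_a zr; exact: cauchy_kernel_continuous.
- by move=> z t /near_a zr; exact: cauchy_kernel_derive.
- exact: cauchy_kernel_continuous.
- by move=> t; exact: cauchy_kernel_continuous2.
Qed.

(** At the centre the integrand is the constant 2 pi i. Differentiation in a gives the integral of
    the derivative of -1 / (circle - a), which vanishes since the circle is closed; so the value is
    the same throughout the disc. *)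
Lemma winding_integral a : `|a - a0| < rho%:C -> cauchy_integral 0 dcircle a = T.
Proof.
move=> ar.
have W0 : cauchy_integral 0 dcircle a0 = T.
  rewrite /cauchy_integral (@integral01_FTC _ _ (fun t => 0 + t%:C * T)).
  - by rewrite !add0r mul1r mul0r subr0.
  - by apply: cauchy_kernel_continuous;
    [exact: continuous_dcircle|rewrite subrr normr0 ltcR].
  move=> t; have -> : cauchy_kernel 0 dcircle a0 t = T; last exact: cderive_line.
  rewrite /cauchy_kernel expr1 mul1r /dcircle mulrAC divff ?mul1r//.
  by apply: circle_neq; rewrite subrr normr0 ltcR.
have Wd b : `|b - a0| < rho%:C -> is_derive b (1 : C) (cauchy_integral 0 dcircle) 0.
  move=> br; have := @cauchy_integral_derive 0 dcircle b continuous_dcircle br.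
  suff -> : cauchy_integral 1 dcircle b = 0 by [].
  rewrite /cauchy_integral (@integral01_FTC _ _ (fun t => - (circle t - b)^-1)).
  - by rewrite circle_closed subrr.
  - by apply: cauchy_kernel_continuous; [exact: continuous_dcircle|].
  move=> t; have zb := circle_neq t br.
  have d0 : is_derive (circle t) (1 : C) (fun w : C => w - b) 1.
    by have := @is_derive_affine R[i] 1 (- b) (circle t);
      under eq_fun do rewrite mul1r addrC.
  have := cderive_comp (@is_derive_inv R[i] (fun w : C => w - b) _ _ zb d0)
    (cderive_circle t).
  move/cderiveN; congr cderive; rewrite /cauchy_kernel mul1r.
  by rewrite mulN1r mulNr opprK mulrC exprVn.
suff E : cauchy_integral 0 dcircle a = cauchy_integral 0 dcircle a0 by rewrite E W0.
pose g (s : R) := cauchy_integral 0 dcircle (a0 + s%:C * (a - a0)).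
have -> : a = a0 + 1%:C * (a - a0) by rewrite mul1r subrKC.
rewrite -[a0 in RHS]addr0 -[0 in RHS](mul0r (a - a0)).
apply: (@curve_cst _ g 0 1) => // s /andP[s0 s1].
rewrite -(mul0r (a - a0)).
apply: (cderive_comp (Wd _ _) (cderive_line _ _ _)).
have E : `|a0 + s%:C * (a - a0) - a0| = s%:C * `|a - a0| by rewrite addrAC subrr add0r
  normrM norm_realc (ger0_norm s0).
rewrite E; apply: (le_lt_trans _ ar).
by rewrite ler_piMl// (lecR s 1).
Qed.
End Circle.

Section Cauchy.
Variable R : realType.
Local Notation C := (Cplx R).
Local Notation Re := complex.Re.
Local Notation Im := complex.Im.

Lemma cauchy_formula (F f : C -> C) (a0 a : C) (rho : R) : 0 < rho ->
  (forall z, `|z - a0| < (2 * rho)%:C -> is_derive z (1 : C) F (f z)) ->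
  (forall z, `|z - a0| < (2 * rho)%:C -> {for z, continuous f}) ->
  `|a - a0| < rho%:C ->
  cauchy_integral a0 rho 0 (fun t => F (circle a0 rho t) * dcircle a0 rho t) a
    = F a * two_pi_i R.
Proof.
move=> rho0 dF cf ar.
pose zeta := circle a0 rho; pose dzeta := dcircle a0 rho.
(* The integral of [F (a + w (zeta - a)) / (zeta - a)] does not depend on [w] in
   [0, 1]; the formula compares its values at 0 and 1. *)
pose H (w : C) (t : R) : C := F (a + w * (zeta t - a)) * (dzeta t * (zeta t - a)^-1).
pose H' (w : C) (t : R) : C := f (a + w * (zeta t - a)) * dzeta t.
have za t : zeta t - a != 0 by exact: circle_neq.
have czeta t : {for t, continuous zeta} by exact: continuous_circle.
have cdzeta t : {for t, continuous dzeta} by exact: continuous_dcircle.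
(* The parameter must range over a complex neighbourhood of [0, 1]. With radius 1/4 the argument of
   F stays within rho + (rho + rho) / 4 of the centre, which is why F is assumed holomorphic on the
   disc of radius 2 rho. *)
have inball s z t : 0 <= s <= 1 -> `|z - s%:C| < (4^-1 : R)%:C ->
    `|a + z * (zeta t - a) - a0| < (2 * rho)%:C.
  move=> /andP[s0 s1] zs.
  have -> : a + z * (zeta t - a) - a0 = (1 - s)%:C * (a - a0) + s%:C * (zeta t - a0)
     + (z - s%:C) * ((zeta t - a0) - (a - a0)) by rewrite rmorphB rmorph1; ring.
  apply: (@le_lt_trans _ _ ((1 - s) * rho + s * rho + 4^-1 * (rho + rho))%:C); last first.
    by rewrite ltcR; lra.
  have -> : ((1 - s) * rho + s * rho + 4^-1 * (rho + rho))%:C =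
    ((1 - s) * rho)%:C + (s * rho)%:C + (4^-1 * (rho + rho))%:C :> C by rewrite -!rmorphD.
  rewrite (le_trans (ler_normD _ _))// lerD//.
    rewrite (le_trans (ler_normD _ _))// lerD//.
      have s1' : 0 <= 1 - s by rewrite subr_ge0.
      rewrite normrM norm_realc (ger0_norm s1') rmorphM.
      by apply: ler_pM; [rewrite ler0c|exact: normr_ge0|exact: lexx|exact: ltW].
    by rewrite normrM norm_realc (ger0_norm s0) rmorphM norm_circle.
  rewrite normrM rmorphM rmorphD; apply: ler_pM;
    [exact: normr_ge0|exact: normr_ge0|exact: ltW|].
  rewrite (le_trans (ler_normB _ _))// lerD//; last exact: ltW.
  by rewrite norm_circle.
have dphi s : 0 <= s <= 1 -> is_derive (s%:C : C) (1 : C) (fun z => integral01 (H z)) 0.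
  move=> s01.
  have inb t : `|a + s%:C * (zeta t - a) - a0| < (2 * rho)%:C.
    by apply: (inball s) => //; rewrite subrr normr0 ltcR invr_gt0.
  have ck (w : C) t : {for t, continuous (fun t => a + w * (zeta t - a))}.
    apply: continuous_addc; first exact: cst_continuous.
    apply: continuous_mulc; first exact: cst_continuous.
    by apply: continuous_addc; [exact: czeta|exact: cst_continuous].
  have cH' : continuous (H' s%:C).
    move=> t; apply: continuous_mulc; last exact: cdzeta.
    exact: (@continuous_comp _ _ _ _ f _ (ck s%:C t) (cf _ (inb t))).
  (* The integrand is the derivative of a closed curve: s^-1 F (a + s (zeta t - a)) when s is
     nonzero, and f(a) zeta t when s = 0, where this formula would divide by zero. *)
  have E0 : integral01 (H' s%:C) = 0.
    have [s0|s0] := eqVneq s 0.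
      rewrite (@integral01_FTC _ _ (fun t => f a * zeta t) cH').
        by rewrite /zeta circle_closed subrr.
      move=> t; have -> : H' s%:C t = f a * dzeta t by rewrite /H' s0 mul0r addr0.
      by apply: cderiveZ; exact: cderive_circle.
    have sC : (s%:C : C) != 0 by rewrite eq_complex /= negb_and s0.
    rewrite (@integral01_FTC _ _ (fun t => s%:C^-1 * F (a + s%:C * (zeta t - a))) cH').
      by rewrite /zeta circle_closed subrr.
    move=> t; have -> : H' s%:C t = s%:C^-1 * (f (a + s%:C * (zeta t - a)) * (0 + s%:C *
      (dzeta t + - 0))).
      by rewrite add0r subr0 /H' [s%:C * _]mulrC !mulrA [LHS]mulrC; field.
    apply: cderiveZ; apply: (cderive_comp (f := F)); first exact: dF.
    apply: cderiveD; first exact: cderive_cst.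
    apply: cderiveZ; apply: cderiveD; first exact: cderive_circle.
    by apply: cderiveN; exact: cderive_cst.
  suff : is_derive (s%:C : C) (1 : C) (fun z => integral01 (H z)) (integral01 (H' s%:C)).
    by rewrite E0.
  have h1 : 0 < (4^-1 : R) by rewrite invr_gt0.
  have h2 (z : C) : `|z - s%:C| < (4^-1 : R)%:C -> continuous (H z).
    move=> zs t; apply: (@continuous_mulc _ _ (fun t => F (a + z * (zeta t - a))) (fun t
      => dzeta t * (zeta t - a)^-1)).
      have cF := @is_derive_continuous R[i] F _ _ (dF _ (inball s z t s01 zs)).
      exact: (@continuous_comp _ _ _ _ F _ (ck z t) cF).
    apply: continuous_mulc; first exact: cdzeta.
    apply: continuous_invc; first exact: za.
    by apply: continuous_addc; [exact: czeta|exact: cst_continuous].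
  have h3 (z : C) t : `|z - s%:C| < (4^-1 : R)%:C -> is_derive z (1 : C) (H^~ t) (H' z t).
    move=> zs.
    have dl := @is_derive_affine R[i] (zeta t - a) a z.
    have dFz := dF _ (inball s z t s01 zs).
    have dl' : is_derive z (1 : C) (fun w : C => a + w * (zeta t - a)) (zeta t - a).
      by move: dl; under eq_fun do rewrite mulrC.
    have := @is_derive_scale R[i] _ _ _ (dzeta t * (zeta t - a)^-1) (@is_derive_chain
      R[i] F (fun w : C => a + w * (zeta t - a)) z _ _ dFz dl').
    have -> : dzeta t * (zeta t - a)^-1 * (f (a + z * (zeta t - a)) * (zeta t - a)) = H'
      z t.
      by rewrite /H'; field; exact: za.
    by congr is_derive; apply/funext => w; rewrite /H mulrC.
  have h5 t : {for (t, s%:C : C), continuous (fun p : R * C => H' p.2 p.1)}.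
    have c1 : {for (t, s%:C : C), continuous (fun p : R * C => p.1)} by exact: cvg_fst.
    have c2 : {for (t, s%:C : C), continuous (fun p : R * C => p.2)} by exact: cvg_snd.
    apply: continuous_mulc; last exact: (@continuous_comp _ _ _ _ dzeta _ c1 (cdzeta t)).
    apply: (@continuous_comp _ _ _ (fun p : R * C => a + p.2 * (zeta p.1 - a)) f);
      last exact: (cf _ (inb t)).
    apply: continuous_addc; first exact: cst_continuous.
    apply: continuous_mulc; first exact: c2.
    apply: continuous_addc; last exact: cst_continuous.
    exact: (@continuous_comp _ _ _ _ zeta _ c1 (czeta t)).
  exact: (derive_under_integral h1 h2 h3 cH' h5).
have phi01 : integral01 (H (0 + 1%:C * 1)) = integral01 (H (0 + 0%:C * 1)).
  apply: (@curve_cst _ (fun s => integral01 (H (0 + s%:C * 1))) 0 1) => // s s01.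
  have E : (0 + s%:C * 1 : C) = s%:C by rewrite add0r mulr1.
  have d0 : is_derive (0 + s%:C * 1 : C) (1 : C) (fun z => integral01 (H z)) 0.
    by rewrite E; exact: dphi.
  by have := cderive_comp d0 (cderive_line 0 1 s); rewrite mul0r.
rewrite -(winding_integral rho0 ar).
have -> : F a * cauchy_integral a0 rho 0 (dcircle a0 rho) a = integral01 (H (0 + 0%:C * 1)).
  rewrite /cauchy_integral -integral01_scale; last first.
    by apply: cauchy_kernel_continuous => //; exact: continuous_dcircle.
  congr integral01; apply/funext => t.
  by rewrite /H add0r mul0r mul0r addr0 /cauchy_kernel expr1 mul1r.
rewrite -phi01; congr integral01; apply/funext => t.
by rewrite /H add0r !mul1r subrKC /cauchy_kernel expr1 mul1r mulrA.
Qed.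

(** Cauchy's formula for a primitive F of f writes F as the term m = 0 of a family of kernel
    integrals in which differentiation is a shift of m. Hence f is the term m = 1, its derivative
    the term m = 2, and the latter is again differentiable. *)
Lemma holomorphic_derive (f : C -> C) (z0 : C) :
  (\forall z \near z0, derivable f z (1 : C)) ->
  exists g : C -> C, \forall z \near z0, is_derive z (1 : C) f (g z) /\ derivable g z (1
    : C).
Proof.
move=> df; have [F dF] := holomorphic_primitive df.
have : \forall z \near z0, derivable f z (1 : C) /\ is_derive z (1 : C) F (f z) by apply:
  filterI.
move=> /nbhsC_ballP[r r0 H].
pose rho := r / 2; have rho0 : 0 < rho by rewrite divr_gt0.
have rE : 2 * rho = r by rewrite /rho; field.
pose g t := F (circle z0 rho t) * dcircle z0 rho t.
pose K m := cauchy_integral z0 rho m g.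
have cf z : `|z - z0| < r%:C -> {for z, continuous f}.
  move=> /H[+ _] => /derivable1_diffP; exact: differentiable_continuous.
have FK z : `|z - z0| < rho%:C -> F z = (two_pi_i R)^-1 * K 0%N z.
  move=> zr; rewrite /K (_ : cauchy_integral z0 rho 0 g z = F z * two_pi_i R).
    by rewrite mulrCA mulVf ?mulr1// two_pi_i_neq0.
  have h1 (w : C) : `|w - z0| < (2 * rho)%:C -> is_derive w (1 : C) F (f w).
    by rewrite rE => /H[].
  have h2 (w : C) : `|w - z0| < (2 * rho)%:C -> {for w, continuous f}.
    by rewrite rE; exact: cf.
  exact: (cauchy_formula rho0 h1 h2 zr).
have cg : continuous g.
  move=> t; apply: continuous_mulc; last exact: continuous_dcircle.
  have ct : {for t, continuous (circle z0 rho)} by exact: continuous_circle.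
  have [|_ dFt] := H (circle z0 rho t).
    by rewrite norm_circle// ltcR -rE; lra.
  have cF := @is_derive_continuous R[i] F _ _ dFt.
  exact: (@continuous_comp _ _ _ _ F _ ct cF).
have dK m z : `|z - z0| < rho%:C -> is_derive z (1 : C) (fun w => (two_pi_i R)^-1 * K m
  w) ((two_pi_i R)^-1 * K m.+1 z).
  by move=> zr; apply: (@is_derive_scale R[i]); exact: cauchy_integral_derive.
have near_ball z : `|z - z0| < rho%:C -> \forall w \near z, `|w - z0| < rho%:C.
  rewrite -subr_gt0 => /gt0_complexE[E q0].
  apply/nbhsC_ballP; eexists; first exact: q0.
  move=> w; rewrite -E => wz; rewrite -(subrKA z) (le_lt_trans (ler_normD _ _))//.
  by rewrite -ltrBrDr.
have fK z : `|z - z0| < rho%:C -> f z = (two_pi_i R)^-1 * K 1%N z.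
  move=> zr; have [|_ [_ <-]] := H z; first by rewrite (lt_trans zr)// ltcR -rE; lra.
  apply: derive_val; apply: (@is_derive_near R[i] _ _ _ _ _ (dK 0%N z zr)).
  by apply: filterS (near_ball z zr) => w /FK ->.
exists (fun z => (two_pi_i R)^-1 * K 2%N z); apply/nbhsC_ballP; exists rho => // z zr.
split; last by have [] := dK 2%N z zr.
apply: (@is_derive_near R[i] _ _ _ _ _ (dK 1%N z zr)).
by apply: filterS (near_ball z zr) => w /fK ->.
Qed.

End Cauchy.

(** * Path integrals of holomorphic forms *)

Section LocalPrimitives.
Variables (R : realType) (S : riemann_surface R).
Local Notation C := (Cplx R).

Lemma near_cdom (phi : chart R S) (x : S) : cdom phi x -> \forall y \near x, cdom phi y.
Proof. by move=> dx; apply: open_nbhs_nbhs; split => //; exact: cdom_open. Qed.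

Lemma near_cmap (phi : chart R S) (x : S) (P : set C) : cdom phi x ->
  (\forall z \near cmap phi x, P z) -> \forall y \near x, cdom phi y /\ P (cmap phi y).
Proof.
move=> dx nP; apply: filterI; first exact: near_cdom.
exact: (cmap_continuous dx nP).
Qed.

(** Transports a neighbourhood in the surface to the chart. The witness y records that z is in the
    image of the chart, where alone [cinv] is meaningful. *)
Lemma near_cinv (phi : chart R S) (x : S) (Q : set S) : cdom phi x ->
  (\forall y \near x, Q y) ->
  \forall z \near cmap phi x, exists y, [/\ cdom phi y, cmap phi y = z, cinv phi z = y &
    Q y].
Proof.
move=> dx nQ.
have img : (cmap phi @` cdom phi) (cmap phi x) by exists x.
have cc := cinv_continuous img.
have n1 : \forall z \near cmap phi x, Q (cinv phi z).
  by apply: cc; rewrite cmapK.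
have n2 : \forall z \near cmap phi x, (cmap phi @` cdom phi) z.
  by apply: open_nbhs_nbhs; split => //; exact: cimg_open.
apply: filterS2 n1 n2 => z Qz [y dy yz]; exists y; split => //.
  by rewrite -yz cmapK.
by rewrite -(cmapK dy) yz.
Qed.

Variable eta : one_form S.

Definition chart_primitive (phi : chart R S) (x : S) (f : S -> C) (G : C -> C) : Prop :=
  [/\ atlas phi, cdom phi x,
      \forall z \near cmap phi x, is_derive z (1 : C) G (eta phi z) &
      \forall y \near x, f y = G (cmap phi y)].

(** A primitive as a function on the surface, with the chart hidden; [chart_primitive_change] reads
    it in any chart of the atlas. *)
Definition local_primitive (x : S) (f : S -> C) : Prop :=
  exists phi G, chart_primitive phi x f G.

Lemma local_primitive_near x f : local_primitive x f ->
  \forall y \near x, local_primitive y f.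
Proof.
move=> [phi [G [aphi dx dG fG]]].
have n1 := near_cmap dx (near_join dG).
apply: filterS2 n1 (near_join fG) => y [dy h1] h2.
by exists phi, G; split.
Qed.

Lemma local_primitive_addr x f (a : C) : local_primitive x f ->
  local_primitive x (fun y => f y + a).
Proof.
move=> [phi [L [aphi dx dL gL]]]; exists phi, (fun z => L z + a); split => //.
  apply: filterS dL => z dLz; rewrite -[eta phi z]addr0.
  exact: (@is_derive_add R[i] L (fun=> a) z _ _ dLz (is_derive_cst _ _ _)).
by apply: filterS gL => y ->.
Qed.

Hypothesis heta : holomorphic_form eta.

Lemma local_primitive_exists (x : S) : exists f, local_primitive x f.
Proof.
have [phi aphi dx] := atlas_cover x.
have : \forall z \near cmap phi x, derivable (eta phi) z (1 : C).
  apply: filterS (near_cinv dx (near_cdom dx)) => z [y [dy <- _ _]].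
  exact: heta.1.
move=> /holomorphic_primitive[G dG].
exists (G \o cmap phi), phi, G; split => //.
by apply: filterS (near_cmap dx dG).
Qed.

(** The chain rule for the transition map produces exactly the factor in the transformation law of a
    holomorphic form. *)
Lemma chart_primitive_change psi x f : local_primitive x f -> atlas psi -> cdom psi x ->
  exists H, chart_primitive psi x f H.
Proof.
move=> [phi [G [aphi dx dG fG]]] apsi dpx.
pose T := transition psi phi.
exists (G \o T); split => //.
  have n1 := near_cinv dpx (near_cmap dx dG).
  apply: filterS n1 => z [y [dpy yz zy [dy dGy]]].
  have dT := atlas_compatible apsi aphi dpy dy.
  have Ty : T (cmap psi y) = cmap phi y by rewrite /T /transition /= cmapK.
  rewrite -yz (heta.2 psi phi y apsi aphi dpy dy).
  apply: (@is_derive_chain R[i] G T); first by rewrite Ty.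
  by rewrite derive1E; exact: derivableP.
have n2 := near_cdom dpx.
by apply: filterS (filterI fG n2) => y [-> dpy]; rewrite /T /transition /= cmapK.
Qed.

Lemma primitive_near_unique (G H g : C -> C) (z0 : C) :
  (\forall z \near z0, is_derive z (1 : C) G (g z)) ->
  (\forall z \near z0, is_derive z (1 : C) H (g z)) ->
  \forall z \near z0, G z - H z = G z0 - H z0.
Proof.
move=> dG dH.
have : \forall z \near z0, is_derive z (1 : C) G (g z) /\ is_derive z (1 : C) H (g z).
  exact: filterI dG dH.
move=> /nbhsC_ballP[r r0 D].
apply/nbhsC_ballP; exists r => // z zr.
pose k (s : R) := G (z0 + s%:C * (z - z0)) - H (z0 + s%:C * (z - z0)).
have -> : G z - H z = k 1 by rewrite /k mul1r subrKC.
have -> : G z0 - H z0 = k 0 by rewrite /k mul0r addr0.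
apply: (@curve_cst _ k 0 1) => // s /andP[s0 s1].
have [|dGs dHs] := D (z0 + s%:C * (z - z0)).
  have E : `|z0 + s%:C * (z - z0) - z0| = s%:C * `|z - z0|.
    by rewrite addrAC subrr add0r normrM norm_realc (ger0_norm s0).
  by rewrite E; apply: (le_lt_trans _ zr); rewrite ler_piMl// (lecR s 1).
rewrite -(subrr (g (z0 + s%:C * (z - z0)) * (z - z0))).
apply: cderiveD; first exact: (cderive_comp dGs (cderive_line _ _ _)).
by apply: cderiveN; exact: (cderive_comp dHs (cderive_line _ _ _)).
Qed.

Lemma local_primitive_unique x f g : local_primitive x f -> local_primitive x g ->
  \forall y \near x, f y - g y = f x - g x.
Proof.
move=> [phi [G [aphi dx dG fG]]] /chart_primitive_change /(_ aphi dx)[H [_ _ dH gH]].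
have n1 := near_cmap dx (primitive_near_unique dG dH).
have n2 : \forall y \near x, f y = G (cmap phi y) /\ g y = H (cmap phi y).
  exact: filterI fG gH.
have [fx gx] := nbhs_singleton n2.
by apply: filterS2 n1 n2 => y [_ h] [-> ->]; rewrite h fx gx.
Qed.

End LocalPrimitives.

Section Lincomb.
Variables (R : realType) (S : riemann_surface R) (h : nat) (om : 'I_h -> one_form S) (a :
  'I_h -> R[i]).
Hypothesis hom : forall k, holomorphic_form (om k).
Local Notation C := (Cplx R).

Lemma lincomb_holomorphic : holomorphic_form (lincomb_form a om).
Proof.
split=> [phi x aphi dx|phi psi x aphi apsi dx px].
  have : is_derive (cmap phi x) (1 : C) (fun z : C => (\sum_k a k * om k phi z) : C)
      (\sum_k a k * 'D_(1:C) (om k phi) (cmap phi x) : C).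
    apply: (@is_derive_sumr R[i] h (fun k z => a k * om k phi z) (fun k z => a k *
      'D_(1:C) (om k phi) z)) => k.
    by apply: (@is_derive_scale R[i]); apply: derivableP; exact: (hom k).1.
  by case.
rewrite /lincomb_form mulr_suml; apply: eq_bigr => k _.
by rewrite -mulrA -((hom k).2 phi psi x).
Qed.

Lemma lincomb_local_primitive x (f : 'I_h -> S -> C) :
  (forall k, local_primitive (om k) x (f k)) ->
  local_primitive (lincomb_form a om) x (fun y => \sum_k a k * f k y).
Proof.
move=> lf; have [phi aphi dx] := atlas_cover x.
have /choice[G HG] k := chart_primitive_change (hom k) (lf k) aphi dx.
exists phi, (fun z => \sum_k a k * G k z); split => //.
  have : \forall z \near cmap phi x, forall k, is_derive z (1 : C) (G k) (om k phi z).
    apply: (@filter_forall C 'I_h (fun k z => is_derive z (1 : C) (G k) (om k phi z))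
      (nbhs (cmap phi x))) => k.
    by have [] := HG k.
  apply: filterS => z dz.
  apply: (@is_derive_sumr R[i] h (fun k z => a k * G k z) (fun k z => a k * om k phi z)).
have : \forall y \near x, forall k, f k y = G k (cmap phi y).
  apply: (@filter_forall S 'I_h (fun k y => f k y = G k (cmap phi y)) (nbhs x)) => k.
  by have [] := HG k.
by apply: filterS => y E; apply: eq_bigr => k _; rewrite E.
Qed.

End Lincomb.

(** The set where h takes the value h p is open and closed in D. The values live in a bare type:
    differences of primitives are complex numbers, but reachability by a path is a proposition. *)
Lemma locally_constant_connected (T : topologicalType) (V : Type) (D : set T) (h : T -> V) :
  connected D -> (forall p, D p -> \forall q \near p, D q -> h q = h p) ->
  forall p q, D p -> D q -> h p = h q.
Proof.
move=> cD loc p q Dp Dq.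
suff : D `&` [set x | h x = h p] = D by move=> /seteqP[_ /(_ q Dq)[_ <-]].
apply: cD; first by exists p.
- exists (interior [set x | D x -> h x = h p]); first exact: open_interior.
  apply/seteqP; split=> x [Dx] /=.
    by move=> hx; split => //; apply: filterS (loc x Dx) => y /[apply]; rewrite hx.
  by move=> /nbhs_singleton /(_ Dx).
- exists (~` interior [set x | D x -> h x <> h p]); first exact/open_closedC/open_interior.
  apply/seteqP; split=> x [Dx] /=.
    by move=> hx; split => // /nbhs_singleton /(_ Dx).
  move=> nint; split => //; apply: contrapT => hx; apply: nint.
  by apply: filterS (loc x Dx) => y /[apply] ->.
Qed.

Lemma continuous_pair (T U V : topologicalType) (f : T -> U) (g : T -> V) (t : T) :
  {for t, continuous f} -> {for t, continuous g} -> {for t, continuous (fun u => (f u, g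
    u))}.
Proof. by move=> cf cg; exact: (cvg_pair cf cg). Qed.

(** * Continuation of primitives along continuous maps, and Stokes for singular simplices *)

Section PrimitiveAlong.
Variables (R : realType) (S : riemann_surface R) (eta : one_form S).
Hypothesis heta : holomorphic_form eta.
Local Notation C := (Cplx R).

(** The germ of the primitive may change from point to point, so F exists even where the form has no
    single-valued primitive on the image. On [0, 1] this is the function in [is_path_integral]; on a
    square it yields homology invariance. *)
Definition primitive_along (T : topologicalType) (D : set T) (sigma : T -> S) (F : T ->
  C) : Prop :=
  forall p, D p -> exists f, local_primitive eta (sigma p) f /\
    \forall q \near p, D q -> F q = f (sigma q).

Lemma primitive_along_unique (T : topologicalType) (D : set T) (sigma : T -> S) (F G : T
  -> C) :
  connected D -> continuous sigma ->
  primitive_along D sigma F -> primitive_along D sigma G ->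
  forall p q, D p -> D q -> F p - G p = F q - G q.
Proof.
move=> cD cs hF hG; apply: (@locally_constant_connected T C D (fun p => F p - G p)) => //
  p Dp.
have [f [lf Ff]] := hF p Dp; have [g [lg Gg]] := hG p Dp.
have n1 : \forall q \near p, f (sigma q) - g (sigma q) = f (sigma p) - g (sigma p).
  exact: (cs p _ (local_primitive_unique heta lf lg)).
have -> : F p = f (sigma p) by exact: nbhs_singleton Ff Dp.
have -> : G p = g (sigma p) by exact: nbhs_singleton Gg Dp.
by apply: filterS (filterI n1 (filterI Ff Gg)) => q [h1 [h2 h3]] Dq; rewrite h2// h3.
Qed.

Lemma primitive_along_comp (T T' : topologicalType) (D : set T) (D' : set T')
    (sigma : T -> S) (sigma' : T' -> S) (gamma : T' -> T) (F : T -> C) :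
  continuous gamma -> (forall t, D' t -> D (gamma t)) ->
  (forall t, D' t -> sigma' t = sigma (gamma t)) ->
  primitive_along D sigma F -> primitive_along D' sigma' (F \o gamma).
Proof.
move=> cg DD ss hF p Dp; have [f [lf Ff]] := hF _ (DD p Dp).
exists f; split; first by rewrite ss.
have n1 : \forall q \near p, D (gamma q) -> F (gamma q) = f (sigma (gamma q)).
  exact: (cg p _ Ff).
by apply: filterS n1 => q h Dq; rewrite /= h ?ss//; exact: DD.
Qed.

(** On the connected intersection F - G is a constant k, so F on A and G + k on B fit together. At a
    common point the two germs differ by a constant, equal to 0 there; away from one of the closed
    sets only the other matters. *)
Lemma primitive_along_glue (T : topologicalType) (A B : set T) (sigma : T -> S) (F G : T
  -> C) :
  closed A -> closed B -> connected (A `&` B) -> A `&` B !=set0 -> continuous sigma ->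
  primitive_along A sigma F -> primitive_along B sigma G ->
  exists H, primitive_along (A `|` B) sigma H.
Proof.
move=> clA clB cAB [p0 [Ap0 Bp0]] cs hF hG.
pose k := F p0 - G p0.
have FG p : A p -> B p -> F p = G p + k.
  move=> Ap Bp; have : F p - G p = F p0 - G p0.
    apply: (@primitive_along_unique T (A `&` B) sigma) => // q [Aq Bq].
      have [f [lf Ff]] := hF q Aq; exists f; split => //.
      by apply: filterS Ff => x h [/h].
    have [f [lf Ff]] := hG q Bq; exists f; split => //.
    by apply: filterS Ff => x h [_ /h].
  by rewrite /k => <-; rewrite subrKC.
pose H p := if pselect (A p) then F p else G p + k.
have HA p : A p -> H p = F p by rewrite /H; case: pselect.
have HB p : B p -> H p = G p + k by rewrite /H; case: pselect => // Ap Bp; exact: FG.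
have outside (D : set T) p : closed D -> ~ D p -> \forall q \near p, ~ D q.
  by move=> clD nDp; apply: open_nbhs_nbhs; split => //; exact: closed_openC.
exists H => p.
have [Ap|nAp] := pselect (A p); have [Bp|nBp] := pselect (B p).
- move=> _; have [f [lf Ff]] := hF p Ap;
  have [g [/(local_primitive_addr k) lg Gg]] := hG p Bp.
  exists f; split => //.
  have n1 : \forall q \near p, f (sigma q) - (g (sigma q) + k) = f (sigma p) - (g (sigma
    p) + k).
    exact: (cs p _ (local_primitive_unique heta lf lg)).
  have E : f (sigma p) - (g (sigma p) + k) = 0.
    rewrite -(nbhs_singleton Ff Ap) -(nbhs_singleton Gg Bp).
    by rewrite -HB// HA// subrr.
  apply: filterS (filterI n1 (filterI Ff Gg)) => q [h1 [h2 h3]] [Aq|Bq].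
    by rewrite HA ?h2.
  by rewrite HB// h3//; apply/esym/eqP; rewrite -subr_eq0 h1 E.
- move=> _; have [f [lf Ff]] := hF p Ap; exists f; split => //.
  apply: filterS (filterI Ff (outside B p clB nBp)) => q [h1 h2] [Aq|//].
  by rewrite HA ?h1.
- move=> _; have [g [/(local_primitive_addr k) lg Gg]] := hG p Bp;
  exists (fun y => g y + k); split => //.
  apply: filterS (filterI Gg (outside A p clA nAp)) => q [h1 h2] [//|Bq].
  by rewrite HB ?h1.
- by case.
Qed.

Definition rectangle (a b c d : R) : set (R * R) := `[a, b]%classic `*` `[c, d]%classic.

Lemma rectangle_closed a b c d : closed (rectangle a b c d).
Proof.
have -> : rectangle a b c d = fst @^-1` `[a, b]%classic `&` snd @^-1` `[c, d]%classic by [].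
by apply: closedI; apply: closed_comp => [x _|];
  [exact: cvg_fst|exact: itv_closed|exact: cvg_snd|exact: itv_closed].
Qed.

Lemma rectangleE a b c d p : rectangle a b c d p <-> (a <= p.1 <= b) /\ (c <= p.2 <= d).
Proof. by rewrite /rectangle /= !in_itv. Qed.

Lemma continuous_pair_l (y : R) : continuous (fun x : R => (x, y)).
Proof.
by move=> t; apply: continuous_pair; [exact: cvg_id|exact: cst_continuous].
Qed.

Lemma continuous_pair_r (x : R) : continuous (fun y : R => (x, y)).
Proof.
by move=> t; apply: continuous_pair; [exact: cst_continuous|exact: cvg_id].
Qed.

(** The common side of two adjacent rectangles, seen as a degenerate rectangle: this is the
    connected intersection needed for gluing. *)
Lemma vertical_connected x c d : connected (rectangle x x c d).
Proof.
have -> : rectangle x x c d = (fun y : R => (x, y)) @` `[c, d]%classic.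
  apply/seteqP; split=> [[u v] /rectangleE[/= /andP[h1 h2] h3]|_ [y /= + <-]].
    by exists v; rewrite /= ?in_itv//; congr (_, _); apply/eqP; rewrite eq_le h1 h2.
  by rewrite in_itv => h; apply/rectangleE; rewrite /= lexx.
apply: connected_continuous_connected; first exact: segment_connected.
exact/continuous_subspaceT/continuous_pair_r.
Qed.

Lemma horizontal_connected a b y : connected (rectangle a b y y).
Proof.
have -> : rectangle a b y y = (fun x : R => (x, y)) @` `[a, b]%classic.
  apply/seteqP; split=> [[u v] /rectangleE[/= h3 /andP[h1 h2]]|_ [x /= + <-]].
    by exists u; rewrite /= ?in_itv//; congr (_, _); apply/eqP; rewrite eq_le h1 h2.
  by rewrite in_itv => h; apply/rectangleE; rewrite /= lexx.
apply: connected_continuous_connected; first exact: segment_connected.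
exact/continuous_subspaceT/continuous_pair_l.
Qed.

Section Square.
Variable sigma : R * R -> S.
Hypothesis cs : continuous sigma.

Let on_rectangle a b c d := exists F, primitive_along (rectangle a b c d) sigma F.

Let glue_horizontal a m b c d : a <= m -> m <= b -> c <= d ->
  on_rectangle a m c d -> on_rectangle m b c d -> on_rectangle a b c d.
Proof.
move=> am mb cd [F hF] [G hG].
have E : rectangle a m c d `&` rectangle m b c d = rectangle m m c d.
  apply/seteqP; split=> [p [/rectangleE h1 /rectangleE h2]|p /rectangleE h];
    first by apply/rectangleE; lra.
  by split; apply/rectangleE; lra.
have U : rectangle a m c d `|` rectangle m b c d = rectangle a b c d.
  apply/seteqP; split=> [p [/rectangleE h|/rectangleE h]|p /rectangleE h];
    try by apply/rectangleE; lra.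
  by have [h1|h1] := leP p.1 m; [left|right]; apply/rectangleE; lra.
rewrite /on_rectangle -U; apply: (primitive_along_glue _ _ _ _ cs hF hG); rewrite ?E.
- exact: rectangle_closed.
- exact: rectangle_closed.
- exact: vertical_connected.
- by exists (m, c); apply/rectangleE => /=; lra.
Qed.

Let glue_vertical a b c m d : c <= m -> m <= d -> a <= b ->
  on_rectangle a b c m -> on_rectangle a b m d -> on_rectangle a b c d.
Proof.
move=> am mb cd [F hF] [G hG].
have E : rectangle a b c m `&` rectangle a b m d = rectangle a b m m.
  apply/seteqP; split=> [p [/rectangleE h1 /rectangleE h2]|p /rectangleE h];
    first by apply/rectangleE; lra.
  by split; apply/rectangleE; lra.
have U : rectangle a b c m `|` rectangle a b m d = rectangle a b c d.
  apply/seteqP; split=> [p [/rectangleE h|/rectangleE h]|p /rectangleE h];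
    try by apply/rectangleE; lra.
  by have [h1|h1] := leP p.2 m; [left|right]; apply/rectangleE; lra.
rewrite /on_rectangle -U; apply: (primitive_along_glue _ _ _ _ cs hF hG); rewrite ?E.
- exact: rectangle_closed.
- exact: rectangle_closed.
- exact: horizontal_connected.
- by exists (a, m); apply/rectangleE => /=; lra.
Qed.

(** A small square is mapped into the domain of one local primitive. Quarters are glued in pairs
    along vertical sides, and the two halves along a horizontal one. *)
Lemma primitive_on_square : exists F, primitive_along (rectangle 0 1 0 1) sigma F.
Proof.
pose P x y s := on_rectangle x (x + s) y (y + s).
suff : P 0 0 1 by rewrite /P !add0r.
apply: (@square_bisection _ P) => [x y s s0|p q _ _].
  have ss u : u + s / 2 + s / 2 = u + s by rewrite -addrA -splitr.
  rewrite /P !ss => h1 h2 h3 h4.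
  apply: (@glue_vertical _ _ _ (y + s / 2)); [lra|lra|lra| |].
    by apply: (glue_horizontal _ _ _ h1 h2); lra.
  by apply: (glue_horizontal _ _ _ h3 h4); lra.
have [f lf] := local_primitive_exists heta (sigma (p, q)).
have : \forall r \near (p, q), local_primitive eta (sigma r) f.
  exact: (cs (local_primitive_near lf)).
move=> [[A B] [/= /nbhs_ballP[e1 e10 hA] /nbhs_ballP[e2 e20 hB]] AB].
exists (Num.min e1 e2); first by rewrite lt_min e10.
move=> x y s; rewrite lt_min => /andP[s0 /andP[s1 s2]] xp yq.
exists (f \o sigma) => -[u v] /rectangleE[/= hu hv]; exists f; split; last exact: filterE.
apply: (AB (u, v)); split => /=.
  by apply: hA; rewrite /ball /= ltr_norml; lra.
by apply: hB; rewrite /ball /= ltr_norml; lra.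
Qed.

End Square.

Definition path_primitive (g : R -> S) (F : R -> C) := @primitive_along R `[0, 1]%classic
  g F.

Lemma path1_continuous (g : path1 R S) : continuous (val g).
Proof. by have /asboolP[] := valP g. Qed.

Lemma path1_clamp (g : path1 R S) t : val g t = val g (clamp t).
Proof. by have /asboolP[_] := valP g. Qed.

(** A path is a map of the square which does not depend on the second coordinate; the primitive is
    restricted to the bottom side. *)
Lemma path_primitive_exists (g : path1 R S) : exists F, path_primitive (val g) F.
Proof.
have cs : continuous (fun p : R * R => val g p.1).
  move=> p; have cg : {for p.1, continuous (val g)} by exact: path1_continuous.
  have c1 : {for p, continuous (fun p : R * R => p.1)} by exact: cvg_fst.
  exact: (continuous_comp c1 cg).
have [F hF] := primitive_on_square cs.
exists (F \o (fun x : R => (x, 0))).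
apply: (primitive_along_comp (@continuous_pair_l 0) _ _ hF) => [t|//].
by rewrite /= in_itv /= => h; apply/rectangleE; rewrite /= lexx ler01.
Qed.

(** The given primitive is a valid witness, and any other differs from it by a constant on the
    connected segment; this determines the value selected by [xget]. *)
Lemma path_integralE (g : path1 R S) (F : R -> C) : path_primitive (val g) F ->
  path_integral eta g = F 1 - F 0.
Proof.
move=> hF.
have isF : is_path_integral eta g (F 1 - F 0).
  exists F; split => // t t01.
  have [|f [[phi [G [aphi dx dG fG]]] Ff]] := hF t; first by rewrite /= in_itv.
  exists phi, G; split => //.
  have n1 : \forall s \near t, f (val g s) = G (cmap phi (val g s)).
    exact: (@path1_continuous g t _ fG).
  apply: filterS (filterI n1 Ff) => s [h1 h2] s01.
  by rewrite h2 ?h1//= in_itv.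
have uniq I : is_path_integral eta g I -> I = F 1 - F 0.
  move=> [F' [hF' ->]].
  have pF' : path_primitive (val g) F'.
    move=> t; rewrite /= in_itv /= => /hF'[phi [G [aphi dx dG FG]]].
    exists (G \o cmap phi); split; first by exists phi, G; split => //; exact: filterE.
    by apply: filterS FG => s h; rewrite in_itv; exact: h.
  have := primitive_along_unique (@segment_connected _ 0 1) (@path1_continuous g) pF' hF.
  move=> /(_ 1 0); rewrite /= !in_itv /= !lexx ler01 => /(_ isT isT).
  by move=> h; rewrite -[F' 1](subrK (F 1)) h; ring.
by rewrite /path_integral; case: xgetP => [I _ /uniq//|/(_ _ isF)].
Qed.

Lemma path_primitive_cst (g : R -> S) F : continuous g ->
  (forall t, 0 <= t <= 1 -> g t = g 0) -> path_primitive g F -> F 1 = F 0.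
Proof.
move=> cg gc hF; have [f lf] := local_primitive_exists heta (g 0).
have hc : path_primitive g (fun=> f (g 0)).
  move=> t; rewrite /= in_itv /= => /gc gt0; exists f; split; first by rewrite gt0.
  by apply: filterE => s; rewrite /= in_itv => /gc ->.
have := primitive_along_unique (@segment_connected _ 0 1) cg hF hc.
move=> /(_ 1 0); rewrite /= !in_itv /= !lexx ler01 => /(_ isT isT).
exact: addIr.
Qed.

Lemma simplex_boundary_integral (s : simplex2 R S) :
  path_integral eta (face 0 s) - path_integral eta (face 1 s) + path_integral eta (face 2
    s) = 0.
Proof.
(* This map collapses the square onto the triangle, its edge [x = 1] going to a
   vertex. *)
pose q (p : R * R) : R * R := (clamp p.1, (1 - clamp p.1) * clamp p.2).
have tri p : triangle (q p).
  have /andP[a0 a1] := clampP p.1; have /andP[b0 b1] := clampP p.2.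
  by split => /=; nra.
have c1 (p : R * R) : {for p, continuous (fun p : R * R => clamp p.1)}.
  have cc : {for p.1, continuous (@clamp R)} by exact: continuous_clamp.
  have h : {for p, continuous (fun p : R * R => p.1)} by exact: cvg_fst.
  exact: (continuous_comp h cc).
have c2 (p : R * R) : {for p, continuous (fun p : R * R => clamp p.2)}.
  have cc : {for p.2, continuous (@clamp R)} by exact: continuous_clamp.
  have h : {for p, continuous (fun p : R * R => p.2)} by exact: cvg_snd.
  exact: (continuous_comp h cc).
have cq : continuous q.
  move=> p; have k1 := c1 p; have k2 := c2 p.
  have k3 : {for p, continuous (fun p : R * R => (1 - clamp p.1) * clamp p.2)}.
    apply: (@continuousM R _ (fun p : R * R => 1 - clamp p.1) (fun p : R * R => clamp
      p.2)) => //.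
    by apply: (@continuousB R R _ (fun=> 1) (fun p : R * R => clamp p.1)) => //;
      exact: cst_continuous.
  exact: (continuous_pair k1 k3).
have cs : continuous (fun p => val s (q p)).
  have /asboolP /subspace_continuousP css := valP s.
  move=> p A /(css _ (tri p)) /cq; rewrite /= !nbhs_simpl /=.
  by apply: (@filterS _ (nbhs p)) => u; apply; exact: tri.
have [F hF] := primitive_on_square cs.
have cl0 : clamp (0 : R) = 0 by rewrite clamp_id// lexx ler01.
have cl1 : clamp (1 : R) = 1 by rewrite clamp_id// lexx ler01.
(* The bottom, left and top sides of the square give the faces 2, 1 and 0, the top one run from
   right to left: q (1 - t, 1) = (1 - t, t). *)
have p2 : path_primitive (val (face 2 s)) (F \o (fun t => (t, 0))).
  apply: (primitive_along_comp (@continuous_pair_l 0) _ _ hF) => t;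
    rewrite /= in_itv /= => t01.
    by apply/rectangleE; rewrite /= lexx ler01.
  by rewrite /face_fun /q /= cl0 mulr0.
have p1 : path_primitive (val (face 1 s)) (F \o (fun t => (0, t))).
  apply: (primitive_along_comp (@continuous_pair_r 0) _ _ hF) => t;
    rewrite /= in_itv /= => t01.
    by apply/rectangleE; rewrite /= lexx ler01.
  by rewrite /face_fun /q /= cl0 subr0 mul1r.
have crev : continuous (fun t : R => (1 - t, 1 : R)).
  move=> t; have k1 : {for t, continuous (fun t : R => 1 - t)}.
    by apply: (@continuousB R R _ (fun=> 1) id); [exact: cst_continuous|exact: cvg_id].
  have k2 : {for t, continuous (fun _ : R => 1 : R)} by exact: cst_continuous.
  exact: (continuous_pair k1 k2).
have p0 : path_primitive (val (face 0 s)) (F \o (fun t => (1 - t, 1))).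
  apply: (primitive_along_comp crev _ _ hF) => t; rewrite /= in_itv /= => t01.
    by apply/rectangleE => /=; lra.
  have t01' : 0 <= 1 - t <= 1 by lra.
  by rewrite /face_fun /q /= cl1 mulr1 !clamp_id// subKr.
have cright : continuous (fun t : R => val s (q (1, t))).
  move=> t; have k1 : {for t, continuous (fun t : R => (1 : R, t))} by exact:
    continuous_pair_r.
  have k2 : {for (1 : R, t), continuous (fun p => val s (q p))} by exact: cs.
  exact: (continuous_comp k1 k2).
have pr : path_primitive (fun t => val s (q (1, t))) (F \o (fun t => (1, t))).
  apply: (primitive_along_comp (@continuous_pair_r 1) _ _ hF) => t;
    rewrite /= in_itv //= => t01.
  by apply/rectangleE; rewrite /= lexx ler01.
(* The three integrals are differences of corner values of F and add up to F (1, 0) - F (1, 1),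
   which vanishes because the side x = 1 is collapsed to a point. *)
have := path_primitive_cst cright _ pr; rewrite /q /= cl1 subrr.
move=> /(_ _)/= E; rewrite (path_integralE p0) (path_integralE p1) (path_integralE p2) /=.
rewrite subrr subr0 E; first by ring.
by move=> t _; rewrite !mul0r.
Qed.

End PrimitiveAlong.

(** * Periods *)

Section FreeGroupSum.
Variables (K : choiceType) (V : zmodType) (b : K -> V).
Implicit Types c d : {freeg K / int}.

(** The common shape of [chain_integral] and [boundary1], so that additivity is proved once for
    both. *)
Definition freeg_sum c : V := \sum_(g <- dom c) b g *~ coeff g c.

(** Chains with different supports are summed over one common list, which makes additivity a
    termwise matter. *)
Lemma freeg_sum_widen c (s : seq K) : uniq s -> {subset dom c <= s} ->
  freeg_sum c = \sum_(g <- s) b g *~ coeff g c.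
Proof.
move=> us cs; rewrite [RHS](bigID (mem (dom c))) /= [X in _ + X]big1 ?addr0; last first.
  by move=> g /coeff_outdom ->; rewrite mulr0z.
rewrite -big_filter; apply: perm_big; apply: uniq_perm; first exact: uniq_dom.
  exact: filter_uniq.
by move=> g; rewrite mem_filter; case: (boolP (g \in dom c)) => //= /cs ->.
Qed.

Lemma freeg_sum_is_zmod_morphism : zmod_morphism freeg_sum.
Proof.
move=> c d; pose s := undup (dom c ++ dom d).
have us : uniq s by exact: undup_uniq.
rewrite (@freeg_sum_widen c s)//; last by move=> g h; rewrite mem_undup mem_cat h.
rewrite (@freeg_sum_widen d s)//; last by move=> g h; rewrite mem_undup mem_cat h orbT.
rewrite (@freeg_sum_widen (c - d) s)//; last by move=> g /domB; rewrite mem_undup.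
by rewrite -sumrB; apply: eq_bigr => g _; rewrite coeffB mulrzBr.
Qed.

HB.instance Definition _ :=
  GRing.isZmodMorphism.Build {freeg K / int} V freeg_sum freeg_sum_is_zmod_morphism.

Lemma freeg_sumU g : freeg_sum << g >> = b g.
Proof. by rewrite /freeg_sum domU1 big_seq1 coeffU eqxx mulr1. Qed.

End FreeGroupSum.

Definition mk_path1 (R : realType) (X : topologicalType) (g : R -> X)
    (cg : continuous g) (gc : forall t, g t = g (clamp t)) : path1 R X :=
  exist (fun g : R -> X => `[< continuous g /\ forall t, g t = g (clamp t) >])
    g (asboolT (conj cg gc)).

Section Periods.
Variables (R : realType) (S : riemann_surface R) (eta : one_form S).
Hypothesis heta : holomorphic_form eta.
Local Notation C := (Cplx R).

Lemma chain_integralE c : chain_integral eta c = freeg_sum (path_integral eta : path1 R S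
  -> R[i]) c.
Proof. by []. Qed.

(** By additivity it suffices that the integral over the boundary of each 2-simplex vanishes. *)
Lemma homologous_integral (c d : chain1 R S) : homologous c d ->
  chain_integral eta c = chain_integral eta d.
Proof.
move=> [e cd]; apply/eqP;
  rewrite -subr_eq0 !chain_integralE -raddfB cd /boundary2 raddf_sum big1// => s _.
by rewrite /= raddfMz raddfD raddfB /= !freeg_sumU simplex_boundary_integral// mul0rz.
Qed.

Lemma cycle_integral_span (n : nat) (e : 'I_n -> chain1 R S) c : homology_basis e ->
  cycle1 c ->
  exists k : 'I_n -> int, chain_integral eta c = \sum_i chain_integral eta (e i) *~ k i.
Proof.
move=> [_ he] /he[k [hk _]]; exists k.
rewrite (homologous_integral hk) chain_integralE raddf_sum; apply: eq_bigr => i _.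
by rewrite /= raddfMz.
Qed.

(** No loop has to be formed: the formal difference is already a cycle, and its integral is exactly
    the difference of the two path integrals. *)
Lemma cycle_pair (g g' : path1 R S) : val g 0 = val g' 0 -> val g 1 = val g' 1 ->
  cycle1 (<< g >> - << g' >>).
Proof.
move=> h0 h1; have E c : boundary1 c = freeg_sum (fun g : path1 R S => << val g 1 >> - <<
  val g 0 >>) c by [].
by rewrite /cycle1 E raddfB /= !freeg_sumU h0 h1 subrr.
Qed.

Lemma cycle_triple (g g' s : path1 R S) : val g 0 = val g' 0 -> val g 1 = val s 0 ->
  val s 1 = val g' 1 -> cycle1 (<< g >> + << s >> - << g' >>).
Proof.
move=> h0 h1 h2; have E c : boundary1 c = freeg_sum (fun g : path1 R S => << val g 1 >> -
  << val g 0 >>) c by [].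
rewrite /cycle1 E raddfB raddfD /= !freeg_sumU h0 h1 h2.
by rewrite [X in X - _]addrC subrKA subrr.
Qed.

(** The path is a straight segment in a chart, short enough that [f] is a local primitive at each of
    its points; [f] composed with the path is then a primitive along it. *)
Lemma local_paths x f : local_primitive eta x f ->
  \forall y \near x, exists2 sg : path1 R S, joins x y sg & path_integral eta sg = f y -
    f x.
Proof.
move=> lf; have [phi [G [aphi dx dG fG]]] := lf.
have /nbhsC_ballP[r r0 Hr] := near_cinv dx (local_primitive_near lf).
have nb : \forall z \near cmap phi x, `|z - cmap phi x| < r%:C by apply/nbhsC_ballP;
  exists r.
apply: filterS (near_cmap dx nb) => y [dy yr].
pose z0 := cmap phi x; pose l (t : R) : C := z0 + (clamp t)%:C * (cmap phi y - z0).
have lr t : `|l t - z0| < r%:C.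
  have /andP[t0 t1] := clampP t.
  have E : `|l t - z0| = (clamp t)%:C * `|cmap phi y - z0|.
    by rewrite /l addrAC subrr add0r normrM norm_realc (ger0_norm t0).
  by rewrite E; apply: (le_lt_trans _ yr); rewrite ler_piMl// (lecR (clamp t) 1).
have cl : continuous l.
  move=> t.
  have k1 : {for t, continuous (@clamp R)} by exact: continuous_clamp.
  have k2 : {for clamp t, continuous (fun t : R => t%:C : C)} by exact: continuous_realc.
  have k3 (v : C) : {for t, continuous (fun _ : R => v)} by exact: cst_continuous.
  exact: (continuous_addc (k3 z0) (continuous_mulc (continuous_comp k1 k2) (k3 (cmap phi
    y - z0)))).
have csg : continuous (cinv phi \o l).
  move=> t; have [y' [dy' yl _ _]] := Hr (l t) (lr t).
  have k1 : {for l t, continuous (cinv phi)} by apply: cinv_continuous; exists y'.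
  exact: (continuous_comp (cl t) k1).
have sgc t : (cinv phi \o l) t = (cinv phi \o l) (clamp t).
  by rewrite /l /= (clamp_id (clampP t)).
pose sg : path1 R S := mk_path1 csg sgc.
have cl0 : clamp (0 : R) = 0 by rewrite clamp_id// lexx ler01.
have cl1 : clamp (1 : R) = 1 by rewrite clamp_id// lexx ler01.
have s0 : val sg 0 = x by rewrite /= /l cl0 mul0r addr0 cmapK.
have s1 : val sg 1 = y by rewrite /= /l cl1 mul1r subrKC cmapK.
exists sg => //.
rewrite -s0 -[in f y]s1; apply: (path_integralE heta (F := f \o val sg)) => t _.
exists f; split; last exact: filterE.
by have [y' [dy' yl zy ly]] := Hr (l t) (lr t); rewrite /= zy.
Qed.

End Periods.

Section LincombIntegral.
Variables (R : realType) (S : riemann_surface R) (h : nat) (om : 'I_h -> one_form S) (a :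
  'I_h -> R[i]).
Hypothesis hom : forall k, holomorphic_form (om k).
Local Notation C := (Cplx R).

Lemma lincomb_path_integral (g : path1 R S) :
  path_integral (lincomb_form a om) g = \sum_k a k * path_integral (om k) g.
Proof.
have /choice[F HF] k := path_primitive_exists (hom k) g.
rewrite (@path_integralE R S _ (lincomb_holomorphic a hom) g (fun t => \sum_k a k * F k t)).
  rewrite -sumrB; apply: eq_bigr => k _.
  by rewrite (path_integralE (hom k) (HF k)) mulrBr.
move=> t t01; have /choice[f Hf] k := HF k t t01.
exists (fun y => \sum_k a k * f k y); split.
  by apply: lincomb_local_primitive => // k; have [] := Hf k.
have : \forall q \near t, forall k, `[0, 1]%classic q -> F k q = f k (val g q).
  apply: (@filter_forall R 'I_h (fun k q => `[0, 1]%classic q -> F k q = f k (val g q))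
    (nbhs t)) => k.
  by have [] := Hf k.
by apply: filterS => q E q01; apply: eq_bigr => k _; rewrite E.
Qed.

Lemma lincomb_chain_integral (c : chain1 R S) :
  chain_integral (lincomb_form a om) c = \sum_k a k * chain_integral (om k) c.
Proof.
rewrite /chain_integral.
under eq_bigr do rewrite lincomb_path_integral mulrz_suml.
rewrite exchange_big /=; apply: eq_bigr => k _; rewrite mulr_sumr.
by apply: eq_bigr => g _; rewrite mulrzAr.
Qed.

End LincombIntegral.

Lemma clamp_le0 (R : realType) (t : R) : t <= 0 -> clamp t = 0.
Proof. by move=> t0; rewrite /clamp min_r ?max_l// (le_trans t0 ler01). Qed.

Lemma clamp_ge1 (R : realType) (t : R) : 1 <= t -> clamp t = 1.
Proof. by move=> t1; rewrite /clamp min_l ?max_r// ler01. Qed.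

(** * Path connectedness of the surface *)

Section PathConnected.
Variables (R : realType) (S : riemann_surface R).

Lemma joins_sym (x y : S) (g : path1 R S) : joins x y g -> exists g', joins y x g'.
Proof.
move=> [g0 g1].
have cg : continuous (fun t : R => val g (1 - t)).
  move=> t; have k1 : {for t, continuous (fun t : R => 1 - t)}.
    by apply: (@continuousB R R _ (fun=> 1) id); [exact: cst_continuous|exact: cvg_id].
  have k2 : {for 1 - t, continuous (val g)} by exact: path1_continuous.
  exact: (continuous_comp k1 k2).
have gc (t : R) : val g (1 - t) = val g (1 - clamp t).
  have [t0|t0] := leP t 0.
    by rewrite path1_clamp (clamp_le0 t0) clamp_ge1 ?subr0//; lra.
  have [t1|t1] := leP 1 t; last by rewrite clamp_id// !ltW.
  by rewrite path1_clamp (clamp_ge1 t1) clamp_le0 ?subrr//; lra.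
exists (mk_path1 cg gc); split => /=; first by rewrite subr0.
by rewrite subrr.
Qed.

Lemma joins_trans (x y z : S) (g g' : path1 R S) : joins x y g -> joins y z g' ->
  exists g'', joins x z g''.
Proof.
move=> [g0 g1] [g0' g1'].
pose k (t : R) := if t <= 2^-1 then val g (2 * t) else val g' (2 * t - 1).
have c1 (t : R) : {for t, continuous (fun t : R => val g (2 * t))}.
  have k1 : {for t, continuous (fun t : R => 2 * t)} by exact: mulrl_continuous.
  have k2 : {for 2 * t, continuous (val g)} by exact: path1_continuous.
  exact: (continuous_comp k1 k2).
have c2 (t : R) : {for t, continuous (fun t : R => val g' (2 * t - 1))}.
  have k1 : {for t, continuous (fun t : R => 2 * t - 1)}.
    have h1 : {for t, continuous (fun t : R => 2 * t)} by exact: mulrl_continuous.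
    have h2 : {for t, continuous (fun _ : R => 1 : R)} by exact: cst_continuous.
    exact: (continuousB h1 h2).
  have k2 : {for 2 * t - 1, continuous (val g')} by exact: path1_continuous.
  exact: (continuous_comp k1 k2).
have ck : continuous k.
  move=> t A nA; have [t2|t2|t2] := ltgtP t 2^-1.
  - have nA' : nbhs (val g (2 * t)) A by move: nA; rewrite /k ltW.
    have n1 : \forall s \near t, s < 2^-1 by exact: lt_nbhsl.
    by apply: filterS (filterI n1 (c1 t A nA')) => s [h1 h2]; rewrite /= /k ltW.
  - have nA' : nbhs (val g' (2 * t - 1)) A by move: nA; rewrite /k leNgt t2.
    have n1 : \forall s \near t, 2^-1 < s by exact: lt_nbhsr.
    by apply: filterS (filterI n1 (c2 t A nA')) => s [h1 h2]; rewrite /= /k leNgt h1.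
  - have nA1 : nbhs (val g (2 * t)) A by move: nA; rewrite /k t2 lexx.
    have nA2 : nbhs (val g' (2 * t - 1)) A.
      by move: nA1; rewrite t2 mulfV// subrr g1 g0'.
    have n1 : \forall s \near t, A (val g (2 * s)) by exact: (c1 t A nA1).
    have n2 : \forall s \near t, A (val g' (2 * s - 1)) by exact: (c2 t A nA2).
    apply: filterS (filterI n1 n2) => s [h1 h2].
    by rewrite /= /k; case: ifP.
have kc t : k t = k (clamp t).
  have [t0|t0] := ltP t 0.
    rewrite (clamp_le0 (ltW t0)) /k !ifT; [|lra|lra].
    by rewrite mulr0 path1_clamp clamp_le0//; lra.
  have [t1|t1] := leP t 1; first by rewrite clamp_id// t0.
  rewrite (clamp_ge1 (ltW t1)) /k !ifF; [|lra|lra].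
  rewrite path1_clamp [RHS]path1_clamp !clamp_ge1//; lra.
exists (mk_path1 ck kc); split; rewrite /= /k.
  by rewrite ifT ?mulr0//; lra.
rewrite ifF; last lra.
by rewrite mulr1 -[RHS]g1'; congr (val g' _); lra.
Qed.

(** Reachability from x is a locally constant proposition, since nearby points are joined by the
    paths of [local_paths]. On the connected surface it equals its value at x, where the constant
    path is available. *)
Lemma path_connected (eta : one_form S) : holomorphic_form eta -> forall x y : S,
  exists g : path1 R S, joins x y g.
Proof.
move=> heta x y.
have cx : continuous (fun _ : R => x) by move=> t; exact: cst_continuous.
have refl : exists g : path1 R S, joins x x g by exists (mk_path1 cx (fun=> erefl)).
have <- // : (exists g : path1 R S, joins x x g) = (exists g : path1 R S, joins x y g).
apply: (locally_constant_connected (h := fun z => exists g : path1 R S, joins x z g)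
  (@surface_connected _ S)) => // p _.
have [f /(local_paths heta)] := local_primitive_exists heta p.
apply: filterS => q [sg psg _] _; apply/propext; split=> -[g hg].
  by have [sg' psg'] := joins_sym psg; exact: joins_trans hg psg'.
exact: joins_trans hg psg.
Qed.

End PathConnected.

(** * Smooth functions on plane domains *)

Section Smooth.
Variable R : realType.
Local Notation C := (Cplx R).
Local Notation Re := complex.Re.
Local Notation Im := complex.Im.
Implicit Types (f g w : C -> C) (z v d : C) (U : set C).

Lemma cderive_slice f z v d : cderive (slice f z v) 0 d -> pderivable f z v /\ pderiv v f
  z = d.
Proof.
move=> [[d1 e1] [d2 e2]]; split; first exact: (conj d1 d2).
by rewrite /pderiv !derive1E e1 e2; case: (d).
Qed.

Lemma pderivable_slice f z v : pderivable f z v -> cderive (slice f z v) 0 (pderiv v f z).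
Proof.
move=> [d1 d2]; have := conj (derivableP d1) (derivableP d2).
by rewrite -!derive1E.
Qed.

Lemma near_slice z v (P : set C) : (\forall y \near z, P y) ->
  \forall t \near (0 : R), P (z + t%:C * v).
Proof.
move=> nP; have cl := cderive_continuous (cderive_line z v 0).
by apply: cl; rewrite mul0r addr0.
Qed.

Lemma slice_near_eq f g z v d : (\forall y \near z, f y = g y) ->
  cderive (slice f z v) 0 d -> cderive (slice g z v) 0 d.
Proof. by move=> fg; apply: cderive_near; exact: (near_slice v fg). Qed.

Lemma slice0 f z v : slice f z v 0 = f z.
Proof. by rewrite /slice mul0r addr0. Qed.

Lemma sliceM f g z v d e : cderive (slice f z v) 0 d -> cderive (slice g z v) 0 e ->
  cderive (slice (fun y => f y * g y) z v) 0 (d * g z + f z * e).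
Proof. by move=> df dg; have := cderiveM df dg; rewrite !slice0. Qed.

Lemma sliceD f g z v d e : cderive (slice f z v) 0 d -> cderive (slice g z v) 0 e ->
  cderive (slice (fun y => f y + g y) z v) 0 (d + e).
Proof. exact: cderiveD. Qed.

Lemma sliceJ f z v d : cderive (slice f z v) 0 d ->
  cderive (slice (fun y => (f y)^*) z v) 0 (d^*).
Proof. exact: cderiveJ. Qed.

Lemma slice_holomorphic f z v d : is_derive z (1 : C) f d ->
  cderive (slice f z v) 0 (d * v).
Proof.
move=> df; have df' : is_derive (z + 0%:C * v : C) (1 : C) f d by rewrite mul0r addr0.
exact: (cderive_comp df' (cderive_line z v 0)).
Qed.

Lemma open_near U z : open U -> U z -> \forall y \near z, U y.
Proof. by move=> oU Uz; exact: open_nbhs_nbhs. Qed.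

Lemma continuous_near_eq f g z : (\forall y \near z, f y = g y) ->
  {for z, continuous f} -> {for z, continuous g}.
Proof.
move=> fg cf; have E := nbhs_singleton fg.
have h : f @ z --> g z by rewrite -E; exact: cf.
move=> A /h nA; have nA' : \forall y \near z, A (f y) by exact: nA.
by apply: filterS (filterI fg nA') => y [/= <-].
Qed.

(** Partial derivatives at a point of the open set U depend only on nearby values. This lets
    formulas valid on U alone replace [pderiv] in the inductions below. *)
Lemma Cn_ext n U f g : open U -> (forall z, U z -> f z = g z) -> Cn n U f -> Cn n U g.
Proof.
move=> oU.
have nfg f1 g1 : (forall z, U z -> f1 z = g1 z) ->
    forall z, U z -> \forall y \near z, f1 y = g1 y.
  by move=> fg z Uz; apply: filterS (open_near oU Uz) => y /fg.
elim: n f g => [|n IH] f g fg [cf H].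
  split; [move=> z Uz|exact: I].
  exact: (continuous_near_eq (nfg _ _ fg z Uz) (cf z Uz)).
have pd z v : U z -> pderivable f z v -> pderivable g z v /\ pderiv v f z = pderiv v g z.
  move=> Uz /pderivable_slice /(slice_near_eq (nfg _ _ fg z Uz)) /cderive_slice[h <-//].
split; first by move=> z Uz; exact: (continuous_near_eq (nfg _ _ fg z Uz) (cf z Uz)).
have [p1 [H1 H2]] := H; split.
  by move=> z Uz; have [q1 q2] := p1 z Uz; split;
    [exact: (pd z 1 Uz q1).1|exact: (pd z 'i Uz q2).1].
split; [apply: IH H1|apply: IH H2] => z Uz; have [q1 q2] := p1 z Uz.
  exact: (pd z 1 Uz q1).2.
exact: (pd z 'i Uz q2).2.
Qed.

Lemma Cn_continuous n U f z : Cn n U f -> U z -> {for z, continuous f}.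
Proof. by case: n => [|n] [cf _]; exact: cf. Qed.

Lemma Cn_pderivable n U f : Cn n.+1 U f ->
  forall z, U z -> pderivable f z 1 /\ pderivable f z 'i.
Proof. by case=> _ []. Qed.

Lemma CnW n U f : Cn n.+1 U f -> Cn n U f.
Proof.
elim: n f => [|n IH] f [cf [p1 [H1 H2]]]; first by split; [exact: cf|exact: I].
split; first exact: cf.
split; first exact: p1.
split; first exact: (IH _ H1).
exact: (IH _ H2).
Qed.

Lemma Cn_intro n U f (w1 wi : C -> C) : open U -> (forall z, U z -> {for z, continuous
  f}) ->
  (forall z, U z -> cderive (slice f z 1) 0 (w1 z)) ->
  (forall z, U z -> cderive (slice f z 'i) 0 (wi z)) ->
  Cn n U w1 -> Cn n U wi -> Cn n.+1 U f.
Proof.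
move=> oU cf d1 di h1 hi; split; first exact: cf.
split.
  by move=> z Uz; split;
    [exact: (cderive_slice (d1 z Uz)).1|exact: (cderive_slice (di z Uz)).1].
split.
  by apply: Cn_ext h1 => // z Uz; rewrite (cderive_slice (d1 z Uz)).2.
by apply: Cn_ext hi => // z Uz; rewrite (cderive_slice (di z Uz)).2.
Qed.

Lemma Cn_slice n U f z v : Cn n.+1 U f -> U z -> v = 1 \/ v = 'i ->
  cderive (slice f z v) 0 (pderiv v f z).
Proof.
move=> /Cn_pderivable h /h[h1 hi] [|] ->; exact: pderivable_slice.
Qed.

Lemma CnD n U f g : open U -> Cn n U f -> Cn n U g -> Cn n U (fun z => f z + g z).
Proof.
move=> oU; elim: n f g => [|n IH] f g hf hg.
  split; [move=> z Uz|exact: I].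
  by apply: continuous_addc; [exact: (Cn_continuous hf)|exact: (Cn_continuous hg)].
have [_ [_ [hf1 hf2]]] := hf; have [_ [_ [hg1 hg2]]] := hg.
apply: (@Cn_intro n U _ (fun z => pderiv 1 f z + pderiv 1 g z) (fun z => pderiv 'i f z +
  pderiv 'i g z) oU).
- by move=> z Uz; apply: continuous_addc;
  [exact: (Cn_continuous hf)|exact: (Cn_continuous hg)].
- by move=> z Uz; apply: sliceD; [apply: (Cn_slice hf)|apply: (Cn_slice hg)] => //; left.
- by move=> z Uz; apply: sliceD; [apply: (Cn_slice hf)|apply: (Cn_slice hg)] => //; right.
- exact: IH.
- exact: IH.
Qed.

Lemma CnM n U f g : open U -> Cn n U f -> Cn n U g -> Cn n U (fun z => f z * g z).
Proof.
move=> oU; elim: n f g => [|n IH] f g hf hg.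
  split; [move=> z Uz|exact: I].
  by apply: continuous_mulc; [exact: (Cn_continuous hf)|exact: (Cn_continuous hg)].
have [_ [_ [hf1 hf2]]] := hf; have [_ [_ [hg1 hg2]]] := hg.
apply: (@Cn_intro n U _ (fun z => pderiv 1 f z * g z + f z * pderiv 1 g z)
   (fun z => pderiv 'i f z * g z + f z * pderiv 'i g z) oU).
- by move=> z Uz; apply: continuous_mulc;
  [exact: (Cn_continuous hf)|exact: (Cn_continuous hg)].
- by move=> z Uz; apply: sliceM; [apply: (Cn_slice hf)|apply: (Cn_slice hg)] => //; left.
- by move=> z Uz; apply: sliceM; [apply: (Cn_slice hf)|apply: (Cn_slice hg)] => //; right.
- by apply: (CnD oU); apply: IH; [|exact: CnW|exact: CnW|].
- by apply: (CnD oU); apply: IH; [|exact: CnW|exact: CnW|].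
Qed.

Lemma Cn_cst n U (a : C) : open U -> Cn n U (fun=> a).
Proof.
move=> oU; elim: n a => [|n IH] a; first by split; [move=> z _;
  exact: cst_continuous|exact: I].
apply: (@Cn_intro n U _ (fun=> 0) (fun=> 0) oU).
- by move=> z _; exact: cst_continuous.
- by move=> z _; exact: cderive_cst.
- by move=> z _; exact: cderive_cst.
- exact: IH.
- exact: IH.
Qed.

Lemma CnJ n U f : open U -> Cn n U f -> Cn n U (fun z => (f z)^*).
Proof.
move=> oU.
have cJ g z : {for z, continuous g} -> {for z, continuous (fun z => (g z)^* : C)}.
  move=> cg; have k : {for g z, continuous (fun z : C => z^* : C)} by exact:
    continuous_conjc.
  exact: (continuous_comp cg k).
elim: n f => [|n IH] f hf.
  by split; [move=> z Uz; apply: cJ; exact: (Cn_continuous hf)|exact: I].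
have [_ [_ [hf1 hf2]]] := hf.
apply: (@Cn_intro n U _ (fun z => (pderiv 1 f z)^*) (fun z => (pderiv 'i f z)^*) oU).
- by move=> z Uz; apply: cJ; exact: (Cn_continuous hf).
- by move=> z Uz; apply: sliceJ; apply: (Cn_slice hf) => //; left.
- by move=> z Uz; apply: sliceJ; apply: (Cn_slice hf) => //; right.
- exact: IH.
- exact: IH.
Qed.

Lemma derive_holomorphic U f : open U -> (forall z, U z -> derivable f z (1 : C)) ->
  forall z, U z -> derivable (fun z => 'D_(1 : C) f z : C) z (1 : C).
Proof.
move=> oU df z Uz.
have : \forall y \near z, derivable f y (1 : C).
  by apply: filterS (open_near oU Uz) => y /df.
move=> /holomorphic_derive[g ng].
have [_ dg] := nbhs_singleton ng.
apply: (@near_eq_derivable R[i] C C g _ _ _ _ dg).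
by apply: filterS ng => y [[_ ->]].
Qed.

(** The partial derivatives along 1 and i are f' and i f', and f' is again holomorphic; hence an
    induction over all holomorphic f at once. *)
Lemma Cn_holomorphic n U f : open U -> (forall z, U z -> derivable f z (1 : C)) -> Cn n U f.
Proof.
move=> oU; elim: n f => [|n IH] f df.
  by split; [move=> z /df /derivable1_diffP; exact: differentiable_continuous|exact: I].
apply: (@Cn_intro n U _ (fun z => 'D_(1 : C) f z * 1) (fun z => 'D_(1 : C) f z * 'i) oU).
- by move=> z /df /derivable1_diffP; exact: differentiable_continuous.
- by move=> z Uz; apply: slice_holomorphic; apply: derivableP; exact: df.
- by move=> z Uz; apply: slice_holomorphic; apply: derivableP; exact: df.
- by apply: CnM; [exact: oU|apply: IH; exact: (derive_holomorphic oU)|exact: Cn_cst].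
- by apply: CnM; [exact: oU|apply: IH; exact: (derive_holomorphic oU)|exact: Cn_cst].
Qed.

(** A bootstrap: if f is C^n, its partial derivatives f w with w smooth are C^n as well, so f is
    C^(n+1). *)
Lemma Cn_logarithmic U f (w1 wi : C -> C) : open U -> (forall z, U z -> {for z,
  continuous f}) ->
  (forall z, U z -> cderive (slice f z 1) 0 (f z * w1 z)) ->
  (forall z, U z -> cderive (slice f z 'i) 0 (f z * wi z)) ->
  (forall n, Cn n U w1) -> (forall n, Cn n U wi) -> forall n, Cn n U f.
Proof.
move=> oU cf d1 di h1 hi; elim=> [|n IH]; first by split; [exact: cf|exact: I].
apply: (Cn_intro oU cf d1 di); first exact: (CnM oU IH (h1 n)).
exact: (CnM oU IH (hi n)).
Qed.

Lemma continuous_Cexp : continuous (@Cexp R).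
Proof.
move=> z; have cr : {for z, continuous (fun z : C => Re z)} by exact: continuous_Re.
have ci : {for z, continuous (fun z : C => Im z)} by exact: continuous_Im.
have ke : {for Re z, continuous (@expR R)} by exact: continuous_expR.
have kc : {for Im z, continuous (@cos R)} by exact: continuous_cos.
have ks : {for Im z, continuous (@sin R)} by exact: continuous_sin.
apply: (@cvg_RI _ _ (nbhs z)).
  exact: (continuousM (continuous_comp cr ke) (continuous_comp ci kc)).
exact: (continuousM (continuous_comp cr ke) (continuous_comp ci ks)).
Qed.

End Smooth.

(** * The eigenfunctions *)

(* In [ring_scope], ['i] and [^*] are those of the algebraically closed field
   [R[i]] rather than the explicit ones. *)
Lemma num_conjE (R : realType) (z : R[i]) : Num.conj z = conjc z.
Proof. by []. Qed.

Lemma conjcM (R : realType) (x y : Cplx R) : conjc (x * y) = conjc x * conjc y :> Cplx R.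
Proof. exact: rmorphM. Qed.

Section Eigenfunction.
Variables (R : realType) (S : riemann_surface R) (eta : one_form S).
Hypothesis heta : holomorphic_form eta.
Local Notation C := (Cplx R).
Local Notation Re := complex.Re.
Local Notation Im := complex.Im.

(** The exponent is 2 i Im (k v), so the values have modulus 1. *)
Definition unit_exp (k v : C) : C := Cexp (k * v - k^* * v^*).

Lemma unit_exp_neq0 k v : unit_exp k v != 0.
Proof. by rewrite -normr_gt0 norm_Cexp ltcR expR_gt0. Qed.

Variables (k : C) (f : S -> R[i]).
Hypothesis hf : forall x, exists l, local_primitive eta x l /\
  \forall y \near x, f y = unit_exp k (l y).

(** The derivative of [f] along the real direction v, divided by [f]: the exponent varies by k u v
    minus its conjugate, where u is the coefficient of the form. *)
Definition log_derivative (phi : chart R S) (v z : C) : C :=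
  k * eta phi z * v + - (k * eta phi z * v)^*.

Lemma in_chart_unit_exp phi x : atlas phi -> cdom phi x ->
  exists F : C -> C, \forall z \near cmap phi x, is_derive z (1 : C) F (eta phi z) /\
    in_chart phi f z = unit_exp k (F z).
Proof.
move=> aphi dx; have [l [ll fl]] := hf x.
have [F [_ _ dF lF]] := chart_primitive_change heta ll aphi dx.
have n1 : \forall y \near x, f y = unit_exp k (F (cmap phi y)).
  by apply: filterS (filterI fl lF) => y [-> ->].
exists F; apply: filterS (filterI dF (near_cinv dx n1)) => z [dFz [y [dy yz zy fy]]].
by split; [exact: dFz|rewrite /in_chart /= zy fy yz].
Qed.

Lemma unit_exp_slice (F : C -> C) z v d : is_derive z (1 : C) F d ->
  cderive (slice (fun y => unit_exp k (F y)) z v) 0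
    (unit_exp k (F z) * (k * d * v + - (k * d * v)^*)).
Proof.
move=> /(slice_holomorphic v) dF.
have dA := cderiveZ k dF; have dB := cderiveN (cderiveZ k^* (cderiveJ dF)).
have := Cexp_derive (cderiveD dA dB); rewrite !slice0.
have -> : k^* * (d * v)^* = (k * d * v)^* by rewrite -rmorphM mulrA.
by rewrite mulrA.
Qed.

Lemma in_chart_slice phi x v : atlas phi -> cdom phi x ->
  cderive (slice (in_chart phi f) (cmap phi x) v) 0
    (f x * log_derivative phi v (cmap phi x)).
Proof.
move=> aphi dx; have [F nF] := in_chart_unit_exp aphi dx.
have [dF fF] := nbhs_singleton nF.
have -> : f x = unit_exp k (F (cmap phi x)) by rewrite -fF /in_chart /= cmapK.
apply: (slice_near_eq _ (unit_exp_slice v dF)).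
by apply: filterS nF => y [_ ->].
Qed.

Lemma in_chart_continuous phi x : atlas phi -> cdom phi x ->
  {for cmap phi x, continuous (in_chart phi f)}.
Proof.
move=> aphi dx; have [F nF] := in_chart_unit_exp aphi dx.
have [dF _] := nbhs_singleton nF.
have cF := @is_derive_continuous R[i] F _ _ dF.
have ck (a : C) : {for cmap phi x, continuous (fun _ : C => a)} by exact: cst_continuous.
have cJ : {for F (cmap phi x), continuous (fun z : C => z^* : C)} by exact:
  continuous_conjc.
have cA := continuous_mulc (ck k) cF.
have cB := continuous_mulc (ck (- k^*)) (continuous_comp cF cJ).
have cE : {for k * F (cmap phi x) + - k^* * (F (cmap phi x))^*, continuous (@Cexp R)}.
  by exact: continuous_Cexp.
apply: (continuous_near_eq _ (continuous_comp (continuous_addc cA cB) cE)).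
by apply: filterS nF => y [_ ->]; rewrite /unit_exp /= mulNr.
Qed.

Lemma chart_form_holomorphic phi : atlas phi ->
  forall z, (cmap phi @` cdom phi) z -> derivable (eta phi) z (1 : C).
Proof. by move=> aphi _ [x dx <-]; exact: heta.1. Qed.

Lemma log_derivative_Cn phi v n : atlas phi ->
  Cn n (cmap phi @` cdom phi) (log_derivative phi v).
Proof.
move=> aphi; have oU := @cimg_open _ _ phi.
have h1 : Cn n (cmap phi @` cdom phi) (fun z => k * eta phi z * v).
  apply: (CnM oU); last exact: Cn_cst.
  apply: (CnM oU); first exact: Cn_cst.
  by apply: (Cn_holomorphic _ oU); exact: chart_form_holomorphic.
have h2 := CnM oU (Cn_cst n (-1) oU) (CnJ oU h1).
by apply: Cn_ext (CnD oU h1 h2) => // z _; rewrite mulN1r.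
Qed.

Lemma unit_exp_smooth : smooth f.
Proof.
move=> phi n aphi; have oU := @cimg_open _ _ phi.
apply: (@Cn_logarithmic R _ _ (log_derivative phi 1) (log_derivative phi 'i) oU).
- by move=> _ [x dx <-]; exact: in_chart_continuous.
- move=> _ [x dx <-]; rewrite {2}/in_chart /= cmapK//; exact: in_chart_slice.
- move=> _ [x dx <-]; rewrite {2}/in_chart /= cmapK//; exact: in_chart_slice.
- by move=> p; exact: log_derivative_Cn.
- by move=> p; exact: log_derivative_Cn.
Qed.

Lemma sqr_ic : 'i%C * 'i%C = -1 :> C.
Proof. exact: (@sqr_i R). Qed.

Lemma conj_ic : conjc 'i%C = - 'i%C :> C.
Proof. by apply: complex_ext; rewrite ?creJ ?cimJ ?creN ?cimN /= ?oppr0. Qed.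

Lemma dzbar_in_chart phi x : atlas phi -> cdom phi x ->
  dzbar (in_chart phi f) (cmap phi x) = f x * - (k * eta phi (cmap phi x))^*.
Proof.
move=> aphi dx; rewrite /dzbar.
rewrite (cderive_slice (in_chart_slice 1 aphi dx)).2 (cderive_slice (in_chart_slice 'i
  aphi dx)).2.
rewrite /log_derivative; move: (k * eta _ _) => a.
rewrite -complexiE !num_conjE mulr1 conjcM conj_ic; set b := conjc a.
(* The square of i is isolated because [ring] treats i as an indeterminate; once it is replaced by
   -1, the holomorphic part a cancels. *)
have -> : f x * (a - b) + 'i%C * (f x * (a * 'i%C - b * - 'i%C)) =
  f x * (a - b + ('i%C * 'i%C) * (a + b)) :> C by ring.
by rewrite sqr_ic; field.
Qed.

(** By the previous lemma d/d(bar z) f is f times the antiholomorphic factor - conj(k u). The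
    operator d/dz does not see this factor and multiplies f by k u; the terms with the derivative of
    u cancel. *)
Lemma dz_dzbar_in_chart phi x : atlas phi -> cdom phi x ->
  dz (dzbar (in_chart phi f)) (cmap phi x) = - f x * (`|k| ^+ 2 * `|eta phi (cmap phi x)|
    ^+ 2).
Proof.
move=> aphi dx.
have oU := @cimg_open _ _ phi.
have Ux : (cmap phi @` cdom phi) (cmap phi x) by exists x.
pose g z : C := in_chart phi f z * - (k * eta phi z)^*.
have gE : \forall z \near cmap phi x, g z = dzbar (in_chart phi f) z.
  apply: filterS (open_near oU Ux) => _ [y dy <-].
  by rewrite dzbar_in_chart// /g /in_chart /= cmapK.
have deta : is_derive (cmap phi x) (1 : C) (eta phi) ('D_(1:C) (eta phi) (cmap phi x)).
  by apply: derivableP; exact: heta.1.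
set d := 'D_(1:C) _ _ in deta.
have dg v : cderive (slice (dzbar (in_chart phi f)) (cmap phi x) v) 0
    (f x * log_derivative phi v (cmap phi x) * - (k * eta phi (cmap phi x))^*
     + f x * - (k * (d * v))^*).
  apply: (slice_near_eq gE).
  have h1 : cderive (slice (fun z => k * eta phi z) (cmap phi x) v) 0 (k * (d * v)).
    exact: (cderiveZ k (slice_holomorphic v deta)).
  have h2 : cderive (slice (fun z => - (k * eta phi z)^*) (cmap phi x) v) 0 (- (k * (d *
    v))^*).
    exact: (cderiveN (sliceJ h1)).
  have := sliceM (in_chart_slice v aphi dx) h2.
  by rewrite {2}/in_chart /= cmapK.
rewrite /dz (cderive_slice (dg 1)).2 (cderive_slice (dg 'i)).2 /log_derivative !sqr_normc.
set u := eta phi _.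
rewrite -complexiE !num_conjE !mulr1 !mulrA !conjcM conj_ic.
set kk := conjc k; set uu := conjc u; set dd := conjc d.
have -> : f x * (k * u - kk * uu) * - (kk * uu) + f x * - (kk * dd) -
  'i%C * (f x * (k * u * 'i%C - kk * uu * - 'i%C) * - (kk * uu) + f x * - (kk * dd * -
    'i%C)) =
  f x * - (kk * uu) * (k * u - kk * uu) + f x * - (kk * dd) - ('i%C * 'i%C) * (f x * -
    (kk * uu) * (k * u + kk * uu) + f x * (kk * dd)) :> C by ring.
by rewrite sqr_ic; field.
Qed.

Lemma unit_exp_eigenfunction (x0 : S) : eigenfunction eta f (2%:R * `|k| ^+ 2).
Proof.
split; first exact: unit_exp_smooth.
  exists x0; have [l [_ /nbhs_singleton ->]] := hf x0; exact: unit_exp_neq0.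
move=> phi x aphi dx ux; rewrite /laplacian dz_dzbar_in_chart//.
have u0 : `|eta phi (cmap phi x)| != 0 by rewrite normr_eq0.
by field; exact: u0.
Qed.

End Eigenfunction.

(** * Invariance under the period lattice *)

Section Periodicity.
Variable R : realType.
Local Notation C := (Cplx R).
Local Notation Re := complex.Re.
Local Notation Im := complex.Im.

Lemma periodicz (f : R -> R) (T : R) : periodic f T -> forall (j : int) a, f (a + T *
  j%:~R) = f a.
Proof.
move=> pf [n|n] a; first by rewrite -pmulrn mulr_natr (periodicn pf).
rewrite NegzE mulrNz mulrN -pmulrn mulr_natr.
by rewrite -[in RHS](subrK (T *+ n.+1) a) (periodicn pf).
Qed.

Lemma unit_expE (k v : C) :
  unit_exp k v = cos (2 * Im (k * v)) +i* sin (2 * Im (k * v)).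
Proof.
rewrite /unit_exp /Cexp !num_conjE.
have E : k * v - conjc k * conjc v = 0 +i* (2 * Im (k * v)) :> C.
  rewrite -conjcM; apply: complex_ext; first by rewrite creD creN creJ subrr.
  by rewrite cimD cimN cimJ opprK /= mulr_natl mulr2n.
by rewrite E /= expR0 !mul1r.
Qed.

(** The exponent doubles the imaginary part, so a shift of Im (k v) by a multiple of pi already
    gives a full period. *)
Lemma unit_exp_shift (k v w : C) (j : int) : Im (k * w) = pi * j%:~R ->
  unit_exp k (v + w) = unit_exp k v.
Proof.
move=> kw; rewrite !unit_expE mulrDr cimD kw mulrDr mulrA.
have -> : 2 * pi = pi *+ 2 :> R by rewrite mulr_natl.
by rewrite (periodicz (@cosD2pi R)) (periodicz (@sinD2pi R)).
Qed.

Lemma intr_complex (a : int) : (a%:~R : R[i]) = (a%:~R)%:C.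
Proof. by rewrite rmorph_int. Qed.

Lemma unit_exp_lattice (c : R[i]) (n m a b : int) (v : C) : Im c != 0 ->
  unit_exp (cnm c n m) (v + a%:~R + b%:~R * conjc c) = unit_exp (cnm c n m) v.
Proof.
(* For C = pi (m - n c) / Im c one has Im C = - pi n and Im (C conj(c)) = - pi m, whence this
   integer for the lattice vector a + b conj(c). *)
move=> y0; rewrite -addrA; apply: (@unit_exp_shift _ _ _ (- (n * a + m * b))).
have -> : cnm c n m = (pi / Im c)%:C * ((m%:~R)%:C - (n%:~R)%:C * c) :> C.
  by rewrite /cnm -!intr_complex rmorphM fmorphV /= mulrAC.
rewrite !intr_complex.
case: c y0 => x y /= y0.
rewrite mulrNz rmorphD rmorphM /=.
by rewrite intrM; field.
Qed.

End Periodicity.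


Section Lattice.
Variables (R : realType) (tau : R[i]).

Definition in_lattice (v : R[i]) : Prop := exists a b : int, v = a%:~R + b%:~R * tau.

Lemma in_lattice0 : in_lattice 0.
Proof. by exists 0, 0; rewrite mul0r addr0. Qed.

Lemma in_latticeD v w : in_lattice v -> in_lattice w -> in_lattice (v + w).
Proof.
move=> [a [b ->]] [a' [b' ->]]; exists (a + a'), (b + b'); rewrite !intrD.
by rewrite mulrDl addrACA.
Qed.

Lemma in_latticeMz v (j : int) : in_lattice v -> in_lattice (v *~ j).
Proof.
move=> [a [b ->]]; exists (a * j), (b * j); rewrite -mulrzr !intrM.
by rewrite mulrDl mulrAC.
Qed.

Lemma in_lattice_sum (I : finType) (f : I -> R[i]) :
  (forall i, in_lattice (f i)) -> in_lattice (\sum_i f i).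
Proof.
by move=> hf; apply: (big_ind in_lattice) => //; [exact: in_lattice0|exact: in_latticeD].
Qed.

Lemma torus_point_eq v w : in_lattice (v - w) -> torus_point tau v = torus_point tau w.
Proof.
move=> [a [b E]]; have -> : v = w + (a%:~R + b%:~R * tau) by rewrite -E subrKC.
apply/seteqP; split=> u [a' [b' ->]].
  by exists (a + a'), (b + b'); rewrite !intrD; ring.
by exists (a' - a), (b' - b); rewrite !intrB; ring.
Qed.

End Lattice.

(** * The map to the torus and the functions on it *)

Section Construction.
Variables (R : realType) (S : riemann_surface R) (eta : one_form S) (tau : R[i]).
Hypothesis heta : holomorphic_form eta.
Hypothesis hper : forall c : chain1 R S, cycle1 c -> in_lattice tau (chain_integral eta c).
Variable z0 : S.
Local Notation C := (Cplx R).

Lemma path_integral_lattice (z : S) (g g' : path1 R S) : joins z0 z g -> joins z0 z g' ->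
  in_lattice tau (path_integral eta g - path_integral eta g').
Proof.
move=> [g0 g1] [g0' g1'].
have /hper : cycle1 (<< g >> - << g' >> : chain1 R S) by apply: cycle_pair;
  rewrite ?g0 ?g0' ?g1 ?g1'.
by rewrite chain_integralE raddfB /= !freeg_sumU.
Qed.

(** Following g, then a short path from x to y, then g' backwards is a cycle. So the integral from
    z0 is, modulo the lattice, a local primitive plus a constant, whatever paths are chosen. *)
Lemma path_integral_local (x : S) (g : path1 R S) (f : S -> C) : joins z0 x g ->
  local_primitive eta x f ->
  \forall y \near x, forall g', joins z0 y g' ->
     in_lattice tau (path_integral eta g + f y - f x - path_integral eta g').
Proof.
move=> [g0 g1] lf; apply: filterS (local_paths heta lf) => y [s [s0 s1] sI] g' [g0' g1'].
have /hper : cycle1 (<< g >> + << s >> - << g' >> : chain1 R S).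
  by apply: cycle_triple; rewrite ?g0 ?g0' ?g1 ?g1' ?s0 ?s1.
by rewrite chain_integralE raddfB raddfD /= !freeg_sumU sI addrA.
Qed.

(** An arbitrary path for each point. The path may jump from one point to the next; the integrals
    then jump by lattice vectors only, up to a local primitive. *)
Let chosen_path : S -> path1 R S := projT1 (choice (path_connected heta z0)).
Let chosen_pathP z : joins z0 z (chosen_path z) := projT2 (choice (path_connected heta
  z0)) z.

Definition torus_map (z : S) : set R[i] := torus_point tau (path_integral eta
  (chosen_path z)).

Lemma torus_mapE z g : joins z0 z g -> torus_map z = torus_point tau (path_integral eta g).
Proof. by move=> jg; apply: torus_point_eq; exact: path_integral_lattice. Qed.

Lemma torus_map_holomorphic : holomorphic_to_torus tau torus_map.
Proof.
move=> phi x aphi dx.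
have [f lf] := local_primitive_exists heta x.
have [F [_ _ dF fF]] := chart_primitive_change heta lf aphi dx.
have n1 := path_integral_local (chosen_pathP x) lf.
pose I0 : C := path_integral eta (chosen_path x) - f x.
exists (fun z => F z + I0).
apply: filterS (filterI dF (near_cinv dx (filterI fF n1))) => z [dFz [y [dy yz zy [fy
  hy]]]].
split.
  by have [] := @is_derive_add R[i] F (fun=> I0) z _ _ dFz (is_derive_cst _ _ _).
rewrite zy; apply/esym/torus_point_eq.
have := hy _ (chosen_pathP y); rewrite fy yz.
by rewrite /I0 [F z + _]addrCA addrA.
Qed.

Variable c : R[i].
Hypothesis c0 : complex.Im c != 0.
Hypothesis tauE : tau = conjc c.

Definition torus_exp (n m : int) (z : S) : R[i] :=
  unit_exp (cnm c n m) (path_integral eta (chosen_path z)).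

Lemma unit_exp_congr n m v w : in_lattice tau (v - w) ->
  unit_exp (cnm c n m) v = unit_exp (cnm c n m) w.
Proof.
move=> [a [b E]]; have -> : v = w + a%:~R + b%:~R * conjc c.
  by rewrite -tauE -addrA -E subrKC.
exact: unit_exp_lattice.
Qed.

Lemma torus_expE n m z g : joins z0 z g ->
  torus_exp n m z = unit_exp (cnm c n m) (path_integral eta g).
Proof. by move=> jg; apply: unit_exp_congr; exact: path_integral_lattice. Qed.

Lemma torus_exp_torus_map n m z v : torus_map z v -> torus_exp n m z = unit_exp (cnm c n
  m) v.
Proof. by move=> [a [b ->]]; rewrite tauE unit_exp_lattice. Qed.

(** The integral along chosen paths is not continuous in general, but it differs from the local
    primitive f + I0 by lattice vectors, which [unit_exp] ignores. *)
Lemma torus_exp_local n m x : exists l, local_primitive eta x l /\ \forall y \near x,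
  torus_exp n m y = unit_exp (cnm c n m) (l y).
Proof.
have [f lf] := local_primitive_exists heta x.
pose I0 : C := path_integral eta (chosen_path x) - f x.
exists (fun y => f y + I0); split; first exact: local_primitive_addr.
apply: filterS (path_integral_local (chosen_pathP x) lf) => y hy.
apply/esym/unit_exp_congr; have := hy _ (chosen_pathP y).
by rewrite /I0 [f y + _]addrCA addrA.
Qed.

Lemma torus_exp_eigenfunction n m : eigenfunction eta (torus_exp n m) (lambda_nm c n m).
Proof. exact: (unit_exp_eigenfunction heta (torus_exp_local n m) z0). Qed.

Lemma lambda_nm0 (m : nat) : lambda_nm c 0 m = 2 * ((pi * m%:R / complex.Im c) ^+ 2)%:C.
Proof.
rewrite /lambda_nm; congr (_ * _).
have -> : cnm c 0 m = (pi * m%:R / complex.Im c)%:C.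
  by rewrite /cnm mul0r subr0 !rmorphM fmorphV /= -pmulrn rmorph_nat.
by rewrite norm_realc -rmorphXn real_normK// num_real.
Qed.

(** For n = 0 and natural m the eigenvalues 2 (pi m / Im c)^2 are pairwise distinct; negative m
    would repeat them. At a point where the form is nonzero the Laplacian is defined and the
    function does not vanish, so equal functions have equal eigenvalues. *)
Lemma torus_exp_infinite : (exists phi x, [/\ atlas phi, cdom phi x & eta phi (cmap phi
  x) != 0]) ->
  infinite_set (range (fun p : int * int => torus_exp p.1 p.2)).
Proof.
move=> [phi [x [aphi dx ux]]].
have inj (m m' : nat) : torus_exp 0 m = torus_exp 0 m' -> m = m'.
  move=> E; have [_ _ /(_ phi x aphi dx ux) h1] := torus_exp_eigenfunction 0 m.
  have [_ _ /(_ phi x aphi dx ux) h2] := torus_exp_eigenfunction 0 m'.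
  have h0 : torus_exp 0 m' x != 0 by exact: unit_exp_neq0.
  move: h1; rewrite E h2 => /(mulIf h0); rewrite !lambda_nm0.
  move=> /mulfI; rewrite pnatr_eq0 => /(_ isT)/complexI; rewrite !exprMn.
  move=> /mulIf; rewrite expf_neq0 ?invr_neq0// => /(_ isT)/mulfI.
  rewrite expf_neq0 ?gt_eqF ?pi_gt0// => /(_ isT)/eqP.
  by rewrite -!natrX eqr_nat eqn_exp2r// => /eqP.
move=> /(sub_finite_set (A := range (fun m : nat => torus_exp 0 m))) fin.
apply: (@infinite_nat);
  rewrite -(@eq_finite_set _ _ (range (fun m : nat => torus_exp 0 m)) setT).
  by apply: fin => _ [m _ <-]; exists (0, m%:Z).
by apply: inj_card_eq => m m' _ _; exact: inj.
Qed.

End Construction.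

(** Here [c] stands for the conjugate of the theorem's c. A cycle is homologous to an integer
    combination of the basis; on alpha the normalisation isolates one coefficient, and on beta the
    relation, solved for the period, gives integer coordinates. *)
Lemma symplectic_periods (R : realType) (S : riemann_surface R) (h : nat)
  (alpha beta : 'I_h -> chain1 R S) (Hsympl : symplectic_basis alpha beta)
  (omega : 'I_h -> one_form S) (Hhol : forall k, holomorphic_form (omega k))
  (Hnorm : forall j k, chain_integral (omega k) (alpha j) = (j == k)%:R)
  (Omega : 'M[R[i]]_h)
  (HOmega : forall j k, Omega j k = chain_integral (omega k) (beta j))
  (n_ m_ n'_ m'_ : 'I_h -> int) (c : R[i])
  (Hrel : forall j, (m'_ j)%:~R - \sum_(k < h) Omega j k * (n'_ k)%:~R =
     c * ((m_ j)%:~R - \sum_(k < h) Omega j k * (n_ k)%:~R)) (d : chain1 R S) :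
  cycle1 d ->
  in_lattice c (chain_integral (lincomb_form (fun k => c * (n_ k)%:~R - (n'_ k)%:~R)
    omega) d).
Proof.
set a := fun k => _; move=> cd; have heta := lincomb_holomorphic a Hhol.
have [k ->] := cycle_integral_span heta Hsympl.1 cd.
apply: in_lattice_sum => i; apply: in_latticeMz.
rewrite lincomb_chain_integral//; case: fintype.split => j.
  exists (- n'_ j), (n_ j).
  rewrite (bigD1 j) //= big1 => [|l lj]; last by rewrite Hnorm eq_sym (negPf lj) mulr0.
  by rewrite Hnorm eqxx mulr1 addr0 mulrNz addrC mulrC.
exists (- m'_ j), (m_ j).
under eq_bigr do rewrite -HOmega mulrBl.
rewrite sumrB.
have -> : \sum_k c * (n_ k)%:~R * Omega j k = c * \sum_k Omega j k * (n_ k)%:~R.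
  by rewrite mulr_sumr; apply: eq_bigr => l _; rewrite -mulrA [_ * Omega _ _]mulrC.
have -> : \sum_k (n'_ k)%:~R * Omega j k = \sum_k Omega j k * (n'_ k)%:~R.
  by apply: eq_bigr => l _; rewrite mulrC.
have /eqP := Hrel j; rewrite mulrBr subr_eq => /eqP; rewrite mulrNz => ->; ring.
Qed.

Lemma lambda_nmE (R : realType) (c : R[i]) (n m : int) : lambda_nm c n m =
  2%:R * (pi : R)%:C ^+ 2 *
  ((m%:~R - c * n%:~R) * (m%:~R - c^* * n%:~R)) / (complex.Im c)%:C ^+ 2.
Proof.
rewrite /lambda_nm sqr_normc /cnm !num_conjE.
have E : conjc ((pi : R)%:C * (m%:~R - n%:~R * c) / (complex.Im c)%:C) =
    (pi : R)%:C * (m%:~R - n%:~R * conjc c) / (complex.Im c)%:C.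
  have jM (x y : R[i]) : conjc (x * y) = conjc x * conjc y by exact: rmorphM.
  have jB (x y : R[i]) : conjc (x - y) = conjc x - conjc y by exact: rmorphB.
  have jz (j : int) : conjc (j%:~R : R[i]) = j%:~R by exact: rmorph_int.
  by rewrite !jM jB jM !jz conjc_inv !conjc_real.
by rewrite E -exprVn; ring.
Qed.

Unset Implicit Arguments.
Set Strict Implicit.
Set Printing Implicit Defensive.

Theorem mainTheorem4 (R : realType) (S : riemann_surface R) (h : nat)
  (S_compact : compact [set: S]) (S_genus : has_genus S h)
  (alpha beta : 'I_h -> chain1 R S) (Hsympl : symplectic_basis alpha beta)
  (omega : 'I_h -> one_form S) (Hbasis : holomorphic_basis omega)
  (Hnorm : forall j k, chain_integral (omega k) (alpha j) = (j == k)%:R)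
  (Omega : 'M[R[i]]_h)
  (HOmega : forall j k, Omega j k = chain_integral (omega k) (beta j))
  (n_ m_ n'_ m'_ : 'I_h -> int) (c : R[i])
  (c_irrational : ~ exists q : rat, c = ratr q)
  (c_im : 0 < complex.Im (c^*))
  (Hrel : forall j, (m'_ j)%:~R - \sum_(k < h) Omega j k * (n'_ k)%:~R =
     c^* * ((m_ j)%:~R - \sum_(k < h) Omega j k * (n_ k)%:~R))
  (z0 : S) :
  let omhat : one_form S :=
    lincomb_form (fun k => c^* * (n_ k)%:~R - (n'_ k)%:~R) omega in
  let tau : R[i] := (Num.sg (complex.Im (c^*)))%:C * c^* in
  exists (w : S -> set R[i]) (hh : int -> int -> S -> R[i]),
    [/\ (forall z g, joins z0 z g -> w z = torus_point tau (path_integral omhat g)),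
        holomorphic_to_torus tau w,
        (forall n m z g, joins z0 z g ->
           hh n m z = Cexp (cnm c n m * path_integral omhat g
                            - (cnm c n m)^* * (path_integral omhat g)^*)) &
        (forall n m z v, w z v ->
           hh n m z = Cexp (cnm c n m * v - (cnm c n m)^* * v^*))] /\
    [/\ (forall n m, eigenfunction omhat (hh n m) (lambda_nm c n m)),
        (forall n m, lambda_nm c n m =
           2%:R * (pi : R)%:C ^+ 2 *
           ((m%:~R - c * n%:~R) * (m%:~R - c^* * n%:~R)) / (complex.Im c)%:C ^+ 2) &
        ((exists phi x, [/\ atlas phi, cdom phi x & omhat phi (cmap phi x) != 0]) ->
         infinite_set (range (fun p : int * int => hh p.1 p.2)))].
Proof.
move=> omhat tau.
(* The imaginary part is positive, so the sign in the period of the torus is 1. *)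
have tauE : tau = conjc c by rewrite /tau gtr0_sg// mul1r.
have heta : holomorphic_form omhat by apply: lincomb_holomorphic => k; exact: Hbasis.1.
have hper d : cycle1 d -> in_lattice tau (chain_integral omhat d).
  rewrite tauE; exact: (symplectic_periods Hsympl Hbasis.1 Hnorm HOmega Hrel).
have c0 : complex.Im c != 0 by move: c_im; rewrite cimJ oppr_gt0 => /lt_eqF ->.
exists (torus_map tau heta z0), (torus_exp heta z0 c); split; split.
- by move=> z g jg; exact: (torus_mapE heta hper jg).
- exact: torus_map_holomorphic.
- by move=> n m z g jg; exact: (torus_expE heta hper c0 tauE n m jg).
- by move=> n m z v; exact: torus_exp_torus_map.
- by move=> n m; exact: (torus_exp_eigenfunction heta hper z0 c0 tauE n m).
- exact: lambda_nmE.
- by move=> ex; exact: (torus_exp_infinite hper c0 tauE ex).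
Qed.
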